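(* Let $X$ and $Y$ be finite partially ordered sets. For each $x\in X$ let $Y_x$ be a totally ordered subset of $Y$. Fix a set $\Psi$ of pairs $(x_1,x_2)$ of elements of $X$ with $x_1<x_2$. Let $T$ be the set of tableaux $f:X\to Y$ such that: $f(x)\in Y_x$ for all $x\in X$; $x_1\le x_2$ implies $f(x_1)\le f(x_2)$; and $(x_1,x_2)\in\Psi$ implies $f(x_1)<f(x_2)$. Let $E\subseteq X\times Y$ contain $\bigcup_{f\in T}f$. Then $\Delta(X,Y,T,E)$ is homeomorphic to a ball or sphere, and it is vertex-decomposable.
   Context: A tableau is a function $f:X\to Y$, identified with its graph in $X\times Y$. For a set $T$ of tableaux and $E\subseteq X\times Y$ containing every $f\in T$, put $v_{(x,y)}:=E\setminus\{(x,y)\}$ for $(x,y)\in E$. The tableau complex $\Delta(X,Y,T,E)$ is the simplicial complex on ground set $\{v_{(x,y)}:(x,y)\in E\}$ whose faces are the sets $\{v_{(x,y)}:(x,y)\in E\setminus F\}$ for $F\subseteq E$ containing (the graph of) some $f\in T$; the facets are the $f\in T$. A simplicial complex is vertex-decomposable if it is a simplex, or it is pure and has a vertex $v$ such that the deletion $\{C\in\Delta: v\notin C\}$ and the link $\{C\in\Delta: v\notin C,\ C\cup\{v\}\in\Delta\}$ are both vertex-decomposable. *)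

(* Defs.v *)
From HB Require Import structures.
From mathcomp Require Import all_boot all_order all_algebra.
From mathcomp Require Import all_classical all_reals all_analysis.

Set Implicit Arguments.
Unset Strict Implicit.
Unset Printing Implicit Defensive.

Import Order.TTheory GRing.Theory Num.Theory.
Import numFieldNormedType.Exports.

Local Open Scope ring_scope.

Section SimplicialComplexes.
Variable V : finType.
Implicit Types (D : {set {set V}}) (v : V).

Definition deletion v D : {set {set V}} :=
  [set C in D | v \notin C]%SET.

Definition link v D : {set {set V}} :=
  [set C : {set V} | (v \notin C) && ((v |: C)%SET \in D)]%SET.

Definition is_simplex D : Prop := exists S : {set V}, D = powerset S.

Definition is_facet D (C : {set V}) : Prop :=
  C \in D /\ (forall C' : {set V}, C' \in D -> C \subset C' -> C' = C).

Definition pure D : Prop :=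
  forall C C' : {set V}, is_facet D C -> is_facet D C' -> #|C| = #|C'|.

(* A vertex of D is a v with [set v] \in D, not merely an element of the
   ambient type.  The void complex (no faces at all, not even the empty one) is
   vertex-decomposable by convention, as a degenerate simplex; deletions and
   links at vertices always contain the empty face, so vd_void never occurs
   inside a derivation for a complex that has a face. *)
Inductive vertex_decomposable : {set {set V}} -> Prop :=
| vd_void : vertex_decomposable finset.set0
| vd_simplex D : is_simplex D -> vertex_decomposable D
| vd_shed D v :
    pure D ->
    [set v]%SET \in D ->
    vertex_decomposable (deletion v D) ->
    vertex_decomposable (link v D) ->
    vertex_decomposable D.

(* Barycentric coordinates, indexed by V through enum_rank; the support of a
   point must be a face. *)
Definition realization (R : realType) D : set 'rV[R]_#|V| :=
  [set p : 'rV[R]_#|V| | [/\ forall i, 0 <= p 0 i,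
                             \sum_i p 0 i = 1 &
      [set v | p 0 (enum_rank v) != 0]%SET \in D]]%classic.

End SimplicialComplexes.

Arguments realization {V} R D.

Definition homeomorphic (S T : topologicalType) : Prop :=
  exists (f : S -> T) (g : T -> S),
    [/\ continuous f, continuous g, cancel f g & cancel g f].

Definition unit_ball (R : realType) (n : nat) : set 'rV[R]_n :=
  [set p : 'rV[R]_n | \sum_i p 0 i ^+ 2 <= 1]%classic.

(* The sphere of dimension n - 1; it is empty for n = 0. *)
Definition unit_sphere (R : realType) (n : nat) : set 'rV[R]_n :=
  [set p : 'rV[R]_n | \sum_i p 0 i ^+ 2 = 1]%classic.

Arguments unit_ball R n : clear implicits.
Arguments unit_sphere R n : clear implicits.

Definition ball_or_sphere (R : realType) (V : finType) (D : {set {set V}}) :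
    Prop :=
  exists n : nat,
    homeomorphic (set_type (realization R D)) (set_type (unit_ball R n)) \/
    homeomorphic (set_type (realization R D)) (set_type (unit_sphere R n)).

Section TableauComplexes.
Variables X Y : finType.

Definition graph (f : {ffun X -> Y}) : {set X * Y} :=
  [set p : X * Y | p.2 == f p.1]%SET.

Definition tableau_vertex (E : {set X * Y}) (p : X * Y) : {set X * Y} :=
  (E :\ p)%SET.

Definition tableau_complex (T : {set {ffun X -> Y}}) (E : {set X * Y}) :
    {set {set {set X * Y}}} :=
  [set [set tableau_vertex E p | p in E :\: F]%SET
     | F : {set X * Y} in powerset E & [exists f in T, graph f \subset F]]%SET.

End TableauComplexes.

Definition poset_tableaux (dX dY : Order.disp_t)
    (X : finPOrderType dX) (Y : finPOrderType dY)
    (Yx : X -> {set Y}) (Psi : {set X * X}) : {set {ffun X -> Y}} :=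
  [set f : {ffun X -> Y} |
     [&& [forall x, f x \in Yx x],
         [forall x1, forall x2, (x1 <= x2)%O ==> (f x1 <= f x2)%O] &
         [forall x1, forall x2, ((x1, x2) \in Psi) ==> (f x1 < f x2)%O]]]%SET.

(* Main.v *)
Require Import Defs.
From HB Require Import structures.
From mathcomp Require Import all_boot all_order all_algebra.
From mathcomp Require Import all_classical all_reals all_analysis.
From mathcomp Require Import lra.

Set Implicit Arguments.
Unset Strict Implicit.
Unset Printing Implicit Defensive.

Import Order.TTheory GRing.Theory Num.Theory.
Import numFieldNormedType.Exports.

Local Open Scope classical_set_scope.
Local Open Scope ring_scope.
(** Let [T] be the set of tableaux. A face, given by the complement [F] of its
   vertices, is interior to the tableau complex exactly when every function with
   graph inside [F] lies in [T], so the complex should be a sphere if [T]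
   contains all functions with graph in [E], and otherwise a ball whose boundary
   consists of the faces whose [F] contains a function outside [T].

   Let [x] be minimal among the points with at least two admissible values, and
   let [y] be the least admissible value at [x]. Resetting the value at [x] to [y]
   maps [T] to itself as soon as some tableau takes the value [y] at [x]. Hence
   [(x, y)] is a shedding vertex: its deletion and its link are the complexes of
   the tableaux with [f x = y] and with [f x <> y].

   For the topology, replace a complex by the cone of nonnegative vectors whose
   support is a face, and look for positively homogeneous homeomorphisms of this
   cone onto [R^m] (sphere) or onto [R^m x R>=0], boundary to boundary (ball).
   In these coordinates gluing the star of a vertex to its deletion along the
   link is an explicit shear, so no theorem on gluing balls is needed. *)

(** * Continuity on a subset *)

(** The charts below are total functions that are meaningful only on a cone. The limit is therefore
    taken along the trace of the neighbourhood filter on [A], and only at points of [A]; subtypes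
    appear only in the final homeomorphisms. *)
Definition continuous_on (S T : topologicalType) (A : set S) (f : S -> T) :=
  forall x, A x -> f @ within A (nbhs x) --> f x.

Section ContinuousOn.
Variables (S T : topologicalType).
Implicit Types (A : set S).

Lemma continuous_continuous_on A (f : S -> T) :
  continuous f -> continuous_on A f.
Proof. by move=> cf x _; apply: cvg_trans (cf x); apply: cvg_app; exact: cvg_within. Qed.

Lemma continuous_onT (f : S -> T) : continuous_on setT f -> continuous f.
Proof. by move=> cf x; have := cf x I; rewrite withinET. Qed.

Lemma continuous_on_nearP A (f : S -> T) : continuous_on A f <->
  forall x P, A x -> nbhs (f x) P -> \forall y \near x, A y -> P (f y).
Proof. by split=> cf x P Ax; exact: cf. Qed.

End ContinuousOn.

Section ContinuousOnComp.
Variables (S T U : topologicalType).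
Implicit Types (A B : set S).

Lemma continuous_on_subset A B (f : S -> T) :
  A `<=` B -> continuous_on B f -> continuous_on A f.
Proof.
move=> sAB /continuous_on_nearP cf; apply/continuous_on_nearP => x P Ax nP.
by apply: filterS (cf x P (sAB _ Ax) nP) => y + Ay; apply; exact: sAB.
Qed.

Lemma continuous_on_eq A (f g : S -> T) :
  (forall x, A x -> f x = g x) -> continuous_on A f -> continuous_on A g.
Proof.
move=> fg /continuous_on_nearP cf; apply/continuous_on_nearP => x P Ax.
rewrite -fg// => nP; apply: filterS (cf x P Ax nP) => y + Ay.
by rewrite fg//; apply.
Qed.

Lemma continuous_on_comp A (B : set T) (f : S -> T) (g : T -> U) :
  continuous_on A f -> (forall x, A x -> B (f x)) -> continuous_on B g ->
  continuous_on A (fun x => g (f x)).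
Proof.
move=> /continuous_on_nearP cf fAB /continuous_on_nearP cg.
apply/continuous_on_nearP => x P Ax /(cg _ _ (fAB _ Ax)) nP.
by apply: filterS (cf x _ Ax nP) => y + Ay; apply => //; exact: fAB.
Qed.

Lemma continuous_on_compT A (f : S -> T) (g : T -> U) :
  continuous_on A f -> continuous g -> continuous_on A (fun x => g (f x)).
Proof.
move=> cf cg; apply: (continuous_on_comp cf (B := setT)) => //.
exact: continuous_continuous_on.
Qed.

End ContinuousOnComp.

Section ContinuousOnProd.
Variables (S T U : topologicalType).
Implicit Types (A B : set S).

Lemma continuous_on_pair A (f : S -> T) (g : S -> U) :
  continuous_on A f -> continuous_on A g ->
  continuous_on A (fun x => (f x, g x)).
Proof. by move=> cf cg x Ax; apply: cvg_pair; [exact: cf|exact: cg]. Qed.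

Lemma continuous_on_cst A (t : T) : continuous_on A (fun=> t).
Proof. by move=> x _; exact: cvg_cst. Qed.

Lemma continuous_on_id A : continuous_on A id.
Proof. by apply: continuous_continuous_on => x; exact: cvg_id. Qed.

Lemma continuous_on_fst A (f : S -> T * U) :
  continuous_on A f -> continuous_on A (fun x => (f x).1).
Proof. by move=> cf; apply: (continuous_on_compT cf (g := fst)) => x; exact: cvg_fst. Qed.

Lemma continuous_on_snd A (f : S -> T * U) :
  continuous_on A f -> continuous_on A (fun x => (f x).2).
Proof. by move=> cf; apply: (continuous_on_compT cf (g := snd)) => x; exact: cvg_snd. Qed.

(** Every glued chart is given by one formula on each of two closed pieces, so this is the source of
    its continuity. *)
Lemma continuous_on_paste A B (f : S -> T) : closed A -> closed B ->
  continuous_on A f -> continuous_on B f -> continuous_on (A `|` B) f.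
Proof.
move=> clA clB /subspace_continuousP cA /subspace_continuousP cB.
exact/subspace_continuousP/withinU_continuous.
Qed.

Lemma closed_preimage (f : S -> T) (B : set T) :
  continuous f -> closed B -> closed (f @^-1` B).
Proof. by move=> cf; apply: preimage_closed => x _; exact: cf. Qed.

End ContinuousOnProd.

Section ContinuousOnReal.
Variables (R : realType) (S : topologicalType) (A : set S).
Implicit Types f g : S -> R.

Lemma continuous_onD f g : continuous_on A f -> continuous_on A g ->
  continuous_on A (fun x => f x + g x).
Proof. by move=> cf cg x Ax; apply: cvgD; [exact: cf|exact: cg]. Qed.

Lemma continuous_onN f : continuous_on A f -> continuous_on A (fun x => - f x).
Proof. by move=> cf x Ax; apply: cvgN; exact: cf. Qed.

Lemma continuous_onB f g : continuous_on A f -> continuous_on A g ->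
  continuous_on A (fun x => f x - g x).
Proof. by move=> cf cg; apply: continuous_onD => //; exact: continuous_onN. Qed.

Lemma continuous_on_min f g : continuous_on A f -> continuous_on A g ->
  continuous_on A (fun x => Num.min (f x) (g x)).
Proof.
move=> cf cg; apply: (continuous_on_compT (continuous_on_pair cf cg)
  (g := fun z : R * R => Num.min z.1 z.2)); exact: min_continuous.
Qed.

Lemma continuous_on_max f g : continuous_on A f -> continuous_on A g ->
  continuous_on A (fun x => Num.max (f x) (g x)).
Proof.
move=> cf cg; apply: (continuous_on_compT (continuous_on_pair cf cg)
  (g := fun z : R * R => Num.max z.1 z.2)); exact: max_continuous.
Qed.

Lemma continuous_on_sqr f : continuous_on A f ->
  continuous_on A (fun x => f x ^+ 2).
Proof. by move=> cf x Ax; rewrite expr2; apply: cvgM; exact: cf. Qed.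

Lemma continuous_on_sqrt f : continuous_on A f ->
  continuous_on A (fun x => Num.sqrt (f x)).
Proof.
move=> cf; apply: (continuous_on_compT cf (g := Num.sqrt)).
exact: sqrt_continuous.
Qed.

Lemma continuous_onV f : (forall x, A x -> f x != 0) -> continuous_on A f ->
  continuous_on A (fun x => (f x)^-1).
Proof. by move=> f0 cf x Ax; apply: cvgV; [exact: f0|exact: cf]. Qed.

Lemma continuous_on_sum (I : finType) (F : I -> S -> R) :
  (forall i, continuous_on A (F i)) -> continuous_on A (fun x => \sum_i F i x).
Proof.
move=> cF x Ax; apply: cvg_big => [z|i _]; last exact: cF.
exact: add_continuous.
Qed.

Lemma continuous_on_coord n (f : S -> 'rV[R]_n) j :
  continuous_on A f -> continuous_on A (fun x => f x 0 j).
Proof.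
move=> cf; apply: (continuous_on_compT cf (g := fun z : 'rV_n => z 0 j)).
exact: coord_continuous.
Qed.

Lemma continuous_on_row n (f : S -> 'rV[R]_n) :
  (forall j, continuous_on A (fun x => f x 0 j)) -> continuous_on A f.
Proof.
move=> cf; apply/continuous_on_nearP => x P Ax [Q nQ sQP].
suff : \forall y \near x, forall j, A y -> Q 0 j (f y 0 j).
  by apply: filterS => y Qy Ay; apply: sQP => i j; rewrite ord1; exact: Qy.
apply: filter_forall => j.
by have /continuous_on_nearP := cf j; apply.
Qed.

Lemma continuous_onZ n f (g : S -> 'rV[R]_n) :
  continuous_on A f -> continuous_on A g -> continuous_on A (fun x => f x *: g x).
Proof.
move=> cf cg; apply: continuous_on_row => j.
apply: (@continuous_on_eq _ _ _ (fun x => f x * g x 0 j)) => [x _|].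
  by rewrite mxE.
by move=> x Ax; apply: cvgM; [exact: cf|exact: continuous_on_coord].
Qed.

Lemma continuous_on_row_mx m n (f : S -> 'rV[R]_m) (g : S -> 'rV[R]_n) :
  continuous_on A f -> continuous_on A g ->
  continuous_on A (fun x => row_mx (f x) (g x)).
Proof.
move=> cf cg; apply: continuous_on_row => j.
case: (split_ordP j) => k ->.
  apply: (continuous_on_eq _ (continuous_on_coord cf)) => x _.
  by rewrite row_mxEl.
apply: (continuous_on_eq _ (continuous_on_coord cg)) => x _.
by rewrite row_mxEr.
Qed.

End ContinuousOnReal.

(** Total functions that are continuous and mutually inverse on [A] and [B] restrict to the
    subtypes; values off [A] and [B] are irrelevant. *)
Lemma homeomorphic_set_type (S T : topologicalType) (A : set S) (B : set T)
    (f : S -> T) (g : T -> S) :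
  continuous_on A f -> continuous_on B g ->
  (forall x, A x -> B (f x)) -> (forall y, B y -> A (g y)) ->
  (forall x, A x -> g (f x) = x) -> (forall y, B y -> f (g y) = y) ->
  homeomorphic (set_type A) (set_type B).
Proof.
have cts (S' T' : topologicalType) (A' : set S') (B' : set T') (f' : S' -> T')
    (fAB : forall x, A' x -> B' (f' x)) : continuous_on A' f' ->
    continuous (fun a : set_type A' =>
      exist _ (f' (sval a)) (mem_set (fAB _ (set_mem (svalP a)))) : set_type B').
  move=> /subspace_continuousP/subspace_sigL_continuousP cf; apply/continuousP.
  move=> _ [W oW <-].
  by move/continuousP: cf => /(_ W oW).
move=> cf cg fAB gBA fK gK.
exists (fun a => exist _ (f (sval a)) (mem_set (fAB _ (set_mem (svalP a))))).
exists (fun b => exist _ (g (sval b)) (mem_set (gBA _ (set_mem (svalP b))))).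
split; [exact: cts|exact: cts| |].
  by move=> [x Ax]; apply: eq_sig_hprop => //=; rewrite fK//; exact: set_mem.
by move=> [x Ax]; apply: eq_sig_hprop => //=; rewrite gK//; exact: set_mem.
Qed.

(** * Cones over simplicial complexes *)

Section Cones.
Variables (R : realType) (V : finType).
Local Notation vec := 'rV[R]_#|V|.
Implicit Types (p q : vec) (u v : V) (D B : {set {set V}}).

Definition coord_at p u : R := p 0 (enum_rank u).

Definition support_at p : {set V} := [set u | coord_at p u != 0]%SET.

Definition cone D : set vec :=
  [set p | (forall u, 0 <= coord_at p u) /\ support_at p \in D].

Definition set_coord v p (t : R) : vec :=
  \row_j (if enum_val j == v then t else p 0 j).

Definition down_closed D :=
  forall C C' : {set V}, C' \in D -> C \subset C' -> C \in D.

Lemma coord_atP p q : (forall u, coord_at p u = coord_at q u) -> p = q.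
Proof.
by move=> pq; apply/rowP => j; have := pq (enum_val j); rewrite /coord_at enum_valK.
Qed.

Lemma coord_at_set v p t u :
  coord_at (set_coord v p t) u = if u == v then t else coord_at p u.
Proof. by rewrite /coord_at mxE enum_rankK. Qed.

Lemma coord_atZ c p u : coord_at (c *: p) u = c * coord_at p u.
Proof. by rewrite /coord_at mxE. Qed.

Lemma set_coord_set v p s t : set_coord v (set_coord v p s) t = set_coord v p t.
Proof. by apply: coord_atP => u; rewrite !coord_at_set; case: eqP. Qed.

Lemma set_coord_id v p t : coord_at p v = t -> set_coord v p t = p.
Proof.
by move=> <-; apply: coord_atP => u; rewrite coord_at_set; case: eqP => // ->.
Qed.

Lemma set_coordZ c v p t : set_coord v (c *: p) (c * t) = c *: set_coord v p t.
Proof.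
by apply: coord_atP => u; rewrite !(coord_at_set, coord_atZ); case: eqP.
Qed.

Lemma support_atZ c p : c != 0 -> support_at (c *: p) = support_at p.
Proof.
by move=> c0; apply/setP => u; rewrite !inE coord_atZ mulf_eq0 negb_or c0.
Qed.

Lemma support_at_set0 v p : support_at (set_coord v p 0) = (support_at p :\ v)%SET.
Proof.
by apply/setP => u; rewrite !inE coord_at_set; case: (u =P v); rewrite ?eqxx.
Qed.

Lemma coneZ D c p : 0 < c -> cone D p -> cone D (c *: p).
Proof.
move=> c0 [p0 pD]; split=> [u|]; last by rewrite support_atZ// gt_eqF.
by rewrite coord_atZ mulr_ge0// ltW.
Qed.

Lemma cone_sub D D' p : D \subset D' -> cone D p -> cone D' p.
Proof. by move=> /fintype.subsetP sDD' [p0 /sDD']. Qed.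

Lemma coord_at_continuous u : continuous (fun p => coord_at p u).
Proof. exact: coord_continuous. Qed.

Lemma continuous_on_coord_at (S : topologicalType) (A : set S) (f : S -> vec) u :
  continuous_on A f -> continuous_on A (fun x => coord_at (f x) u).
Proof. exact: continuous_on_coord. Qed.

Lemma continuous_on_set_coord (S : topologicalType) (A : set S) (f : S -> vec)
    (t : S -> R) v :
  continuous_on A f -> continuous_on A t ->
  continuous_on A (fun x => set_coord v (f x) (t x)).
Proof.
move=> cf ct; apply: continuous_on_row => j.
case: (eqVneq (enum_val j) v) => jv.
  by apply: (continuous_on_eq _ ct) => x _; rewrite mxE jv eqxx.
apply: (continuous_on_eq _ (continuous_on_coord (j := j) cf)) => x _.
by rewrite mxE (negbTE jv).
Qed.

(** The cone is a finite union, over the faces [C], of the closed orthants of vectors vanishing off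
    [C]. Down-closure puts the points of such an orthant with smaller support back into the cone. *)
Lemma closed_cone D : down_closed D -> closed (cone D).
Proof.
move=> dD.
have -> : cone D = \bigcup_(C in [set C | C \in D])
    \bigcap_(u in setT) ([set p | 0 <= coord_at p u] `&`
      [set p | u \notin C -> coord_at p u = 0]).
  apply/seteqP; split=> [p [p0 pD]|p [C /= CD pC]].
    exists (support_at p) => //= u _; split => //=.
    by rewrite inE negbK => /eqP.
  split=> [u|]; first by have [] := pC u I.
  apply: dD CD _; apply/fintype.subsetP => u; rewrite inE; apply: contraNT => uC.
  by apply/eqP; have [_] := pC u I; apply.
apply: closed_bigcup => [|C _]; first exact: finite_finset.
apply: closed_bigI => u _; apply: closedI.
  exact: (closed_preimage (@coord_at_continuous u) (@closed_ge _ 0)).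
case: (boolP (u \in C)) => uC.
  by rewrite (_ : mkset _ = setT); [exact: closedT|apply/seteqP; split].
rewrite (_ : mkset _ = (fun p => coord_at p u) @^-1` [set x | x = 0]).
  exact: (closed_preimage (@coord_at_continuous u) (@closed_eq _ 0)).
by apply/seteqP; split => p /=; auto.
Qed.

Definition halfspace m : set ('rV[R]_m * R) := [set z | 0 <= z.2].

(* Homogeneity makes such a homeomorphism of cones descend to the
   realizations: [R^m] becomes a sphere and the half-space a ball. *)
Definition sphere_chart D m (f : vec -> 'rV[R]_m) (g : 'rV[R]_m -> vec) :=
  [/\ continuous_on (cone D) f /\ continuous g,
      forall p, cone D p -> g (f p) = p,
      forall z, cone D (g z) /\ f (g z) = z &
      forall (c : R) p, 0 < c -> cone D p -> f (c *: p) = c *: f p].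

(** [B] records which faces are carried to the boundary hyperplane. Gluing needs this information,
    because two charts are matched along boundary faces. *)
Definition ball_chart D B m (f : vec -> 'rV[R]_m * R) (g : 'rV[R]_m * R -> vec) :=
  [/\ continuous_on (cone D) f /\ continuous_on (@halfspace m) g,
      forall p, cone D p -> halfspace (f p) /\ g (f p) = p,
      forall z, halfspace z -> cone D (g z) /\ f (g z) = z,
      forall (c : R) p, 0 < c -> cone D p -> f (c *: p) = (c *: (f p).1, c * (f p).2) &
      forall p, cone D p -> ((f p).2 == 0) = (support_at p \in B)].

Definition conical_sphere D := exists m f g, @sphere_chart D m f g.

Definition conical_ball D B := exists m f g, @ball_chart D B m f g.

Lemma closed_halfline_coord v : closed [set p | 0 <= coord_at p v].
Proof. exact: (closed_preimage (@coord_at_continuous v) (@closed_ge _ 0)). Qed.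

(** * Coning, and attaching the star of a vertex *)

Lemma conical_ball_vertex v : conical_ball (powerset [set v]%SET) [set finset.set0]%SET.
Proof.
exists 0%N, (fun p => (0, coord_at p v)), (fun z => set_coord v 0 z.2).
have coneE p : cone (powerset [set v]%SET) p ->
    0 <= coord_at p v /\ forall u, u != v -> coord_at p u = 0.
  move=> [p0 pv]; split => // u uv; apply/eqP; apply: contraT => pu.
  move: pv; rewrite inE => /fintype.subsetP/(_ u); rewrite !inE pu (negbTE uv).
  by move=> /(_ isT).
split.
- split.
    apply: continuous_on_pair; first exact: continuous_on_cst.
    apply: continuous_on_coord_at; exact: continuous_on_id.
  apply: continuous_on_set_coord; first exact: continuous_on_cst.
  apply: continuous_on_snd; exact: continuous_on_id.
- move=> p /coneE[p0 pu]; split => //; apply: coord_atP => u.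
  rewrite coord_at_set; case: eqP => [->//|/eqP uv].
  by rewrite pu// /coord_at mxE.
- move=> [x r] /= r0; split; last by rewrite coord_at_set eqxx [x]thinmx0.
  split=> [u|].
    by rewrite coord_at_set; case: eqP => // _; rewrite /coord_at mxE.
  rewrite inE; apply/fintype.subsetP => u; rewrite !inE coord_at_set.
  by case: (u =P v) => // _; rewrite /coord_at mxE eqxx.
- by move=> c p _ _; rewrite coord_atZ scaler0.
- move=> p /coneE[p0 pu] /=; rewrite inE; apply/eqP/eqP => [pv|].
    apply/setP => u; rewrite !inE; apply/negbF/eqP.
    by case: (eqVneq u v) => [->//|/pu].
  by move/setP/(_ v); rewrite !inE => /negbFE/eqP.
Qed.

(** Identifies [R^m x R] with [R^(m+1)], so that the target of a new chart is again a space of row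
    vectors. *)
Definition snoc m (x : 'rV[R]_m) (r : R) : 'rV[R]_(m + 1) := row_mx x r%:M.

Definition last_coord m (z : 'rV[R]_(m + 1)) : R := z 0 (rshift m ord0).

Lemma snocK m (x : 'rV[R]_m) r : lsubmx (snoc x r) = x.
Proof. exact: row_mxKl. Qed.

Lemma last_coord_snoc m (x : 'rV[R]_m) r : last_coord (snoc x r) = r.
Proof. by rewrite /last_coord row_mxEr mxE eqxx. Qed.

Lemma snoc_last m (z : 'rV[R]_(m + 1)) : snoc (lsubmx z) (last_coord z) = z.
Proof.
rewrite -[RHS]hsubmxK; congr row_mx; apply/rowP => j.
by rewrite !ord1 !mxE eqxx.
Qed.

Lemma snocZ m c (x : 'rV[R]_m) r : snoc (c *: x) (c * r) = c *: snoc x r.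
Proof. by rewrite /snoc scale_row_mx scale_scalar_mx. Qed.

Lemma continuous_on_snoc (S : topologicalType) (A : set S) m (f : S -> 'rV[R]_m)
    (r : S -> R) :
  continuous_on A f -> continuous_on A r ->
  continuous_on A (fun x => snoc (f x) (r x)).
Proof.
move=> cf cr; apply: continuous_on_row_mx => //; apply: continuous_on_row => j.
by apply: (continuous_on_eq _ cr) => x _; rewrite ord1 mxE eqxx.
Qed.

Lemma continuous_on_lsubmx (S : topologicalType) (A : set S) m
    (f : S -> 'rV[R]_(m + 1)) :
  continuous_on A f -> continuous_on A (fun x => lsubmx (f x)).
Proof.
move=> cf; apply: continuous_on_row => j.
apply: (continuous_on_eq _ (continuous_on_coord (j := lshift 1 j) cf)) => x _.
by rewrite mxE.
Qed.

Lemma continuous_on_last_coord (S : topologicalType) (A : set S) m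
    (f : S -> 'rV[R]_(m + 1)) :
  continuous_on A f -> continuous_on A (fun x => last_coord (f x)).
Proof. exact: continuous_on_coord. Qed.

(* [(u, t) |-> (u - t, min u t)] opens the quadrant into a half-plane. *)
Lemma conical_ball_cone v (K BK : {set {set V}}) :
  (forall C : {set V}, C \in K -> v \notin C) -> conical_ball K BK ->
  conical_ball [set C : {set V} | (C :\ v)%SET \in K]%SET
    [set C : {set V} | ((C :\ v)%SET \in BK) || (v \notin C)]%SET.
Proof.
move=> vK [m [f [g [[cf cg] fP gP fZ fB]]]].
set D := [set C : {set V} | _]%SET.
have coneD p : cone D p -> 0 <= coord_at p v /\ cone K (set_coord v p 0).
  move=> [p0 pD]; split => //; split=> [u|].
    by rewrite coord_at_set; case: eqP.
  by rewrite support_at_set0; move: pD; rewrite inE.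
have cone_v q : cone K q -> coord_at q v = 0.
  by move=> [_ /vK]; rewrite inE negbK => /eqP.
have coneD' q t : cone K q -> 0 <= t -> cone D (set_coord v q t).
  move=> Kq t0; split=> [u|].
    by rewrite coord_at_set; case: eqP => // _; case: Kq.
  by rewrite inE -support_at_set0 set_coord_set set_coord_id ?cone_v//; case: Kq.
pose fu p := (f (set_coord v p 0)).2.
(* With [s = u - t] and [w = min u t], the quadrant coordinates are recovered as [u = w + max s 0]
   and [t = w + max (- s) 0]. *)
exists (m + 1)%N, (fun p => (snoc (f (set_coord v p 0)).1 (fu p - coord_at p v),
                       Num.min (fu p) (coord_at p v))),
  (fun z => set_coord v (g (lsubmx z.1, z.2 + Num.max (last_coord z.1) 0))
                        (z.2 + Num.max (- last_coord z.1) 0)).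
have cq : continuous_on (cone D) (fun p => f (set_coord v p 0)).
  apply: (continuous_on_comp (B := cone K) _ _ cf) => [|p /coneD[]//].
  apply: continuous_on_set_coord; last exact: continuous_on_cst.
  exact: continuous_on_id.
have cv : continuous_on (cone D) (fun p => coord_at p v).
  apply: continuous_on_coord_at; exact: continuous_on_id.
have fu0 p : cone D p -> 0 <= fu p by move=> /coneD[_] /fP[].
split.
- split.
    apply: continuous_on_pair.
      apply: continuous_on_snoc; first exact: continuous_on_fst.
      apply: continuous_onB => //; exact: continuous_on_snd.
    apply: continuous_on_min => //; exact: continuous_on_snd.
  have c2 : continuous_on (@halfspace (m + 1)) snd.
    apply: continuous_on_snd; exact: continuous_on_id.
  have c1 : continuous_on (@halfspace (m + 1)) fst.
    apply: continuous_on_fst; exact: continuous_on_id.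
  have cl := continuous_on_last_coord c1.
  apply: continuous_on_set_coord.
    apply: (continuous_on_comp (B := @halfspace m) _ _ cg) => [|z z0].
      apply: continuous_on_pair; first exact: continuous_on_lsubmx.
      apply: continuous_onD => //; apply: continuous_on_max => //.
      exact: continuous_on_cst.
    by rewrite /halfspace /= addr_ge0// le_max lexx orbT.
  apply: continuous_onD => //; apply: continuous_on_max.
    exact: continuous_onN.
  exact: continuous_on_cst.
- move=> p Dp; have [pv Kp] := coneD _ Dp; split.
    by rewrite /halfspace /= le_min fu0.
  rewrite /= snocK last_coord_snoc opprB.
  have -> : Num.min (fu p) (coord_at p v) + Num.max (fu p - coord_at p v) 0 = fu p.
    by rewrite -[X in _ + Num.max _ X](subrr (coord_at p v)) -addr_maxl addrA
      addr_min_max addrK.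
  have -> : Num.min (fu p) (coord_at p v) + Num.max (coord_at p v - fu p) 0
      = coord_at p v.
    by rewrite -[X in _ + Num.max _ X](subrr (fu p)) -addr_maxl addrA
      minC addr_min_max addrK.
  rewrite /fu -surjective_pairing (proj2 (fP _ Kp)) set_coord_set.
  exact: set_coord_id.
- move=> [x w] /= w0.
  set u := w + Num.max _ 0; set t := w + _.
  have u0 : 0 <= u by rewrite addr_ge0// le_max lexx orbT.
  have t0 : 0 <= t by rewrite addr_ge0// le_max lexx orbT.
  have [Kq fq] := gP (lsubmx x, u) u0.
  split; first exact: coneD'.
  rewrite /fu set_coord_set coord_at_set eqxx set_coord_id ?cone_v// fq /=.
  congr pair.
    rewrite -[RHS]snoc_last; congr snoc; rewrite /u /t.
    by case: (leP 0 (last_coord x)); case: (leP 0 (- last_coord x)); lra.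
  rewrite /u /t; case: (leP 0 (last_coord x)); case: (leP 0 (- last_coord x)) => ? ?;
    rewrite /Order.min; case: ltP => ?; lra.
- move=> c p c0 Dp; have [pv Kp] := coneD _ Dp.
  rewrite /fu (_ : set_coord v (c *: p) 0 = c *: set_coord v p 0); last first.
    by rewrite -set_coordZ mulr0.
  rewrite fZ//= coord_atZ -mulrBr snocZ; congr pair.
  by rewrite minr_pMr// ltW.
(* The minimum of two nonnegative numbers vanishes when one of them does: [fu p = 0] is the boundary
   of [K], and a zero coordinate at [v] means that the face misses [v]. *)
- move=> p Dp; have [pv Kp] := coneD _ Dp.
  rewrite /= !inE negbK -support_at_set0 -fB// -/(fu p).
  have := fu0 _ Dp; rewrite le_eqVlt eq_sym => /predU1P[->|u0].
    by rewrite min_l// eqxx.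
  move: pv; rewrite le_eqVlt eq_sym => /predU1P[->|v0].
    by rewrite eqxx min_r ?ltW// eqxx orbT.
  by rewrite !gt_eqF// lt_min u0.
Qed.

End Cones.

(** * Gluing the closed star of a vertex to its deletion *)

Section Gluing.
Variables (R : realType) (V : finType) (v : V).
Local Notation vec := 'rV[R]_#|V|.
Implicit Types (p q : vec) (D M BL : {set {set V}}).

Lemma down_closed_deletion D : down_closed D -> down_closed (deletion v D).
Proof.
move=> dD C C'; rewrite !inE => /andP[C'D vC'] CC'.
by rewrite (dD _ _ C'D CC') /=; apply: contra vC'; exact/fintype.subsetP.
Qed.

Lemma down_closed_link D : down_closed D -> down_closed (link v D).
Proof.
move=> dD C C'; rewrite !inE => /andP[vC' C'D] CC'.
rewrite (dD _ _ C'D (finset.setUS _ CC')) andbT.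
by apply: contra vC'; exact/fintype.subsetP.
Qed.

Lemma link_sub_deletion D : down_closed D -> link v D \subset deletion v D.
Proof.
move=> dD; apply/fintype.subsetP => C; rewrite !inE => /andP[-> vCD].
by rewrite (dD _ _ vCD (subsetU1 _ _)).
Qed.

(** The cone over the closed star of [v], presented as the product of the cone over the link with
    the half-line of the [v]-coordinate. *)
Definition star_cone D : set vec :=
  [set p | 0 <= coord_at p v /\ cone (link v D) (set_coord v p 0)].

Lemma closed_star_cone D : down_closed D -> closed (star_cone D).
Proof.
move=> dD; apply: closedI; first exact: closed_halfline_coord.
apply: (closed_preimage (f := fun p : vec => set_coord v p 0)).
  apply: continuous_onT; apply: continuous_on_set_coord; first exact: continuous_on_id.
  exact: continuous_on_cst.
exact/closed_cone/down_closed_link.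
Qed.

Lemma cone_deletion_coord D p : cone (deletion v D) p -> coord_at p v = 0.
Proof. by move=> [_]; rewrite !inE => /andP[_]; rewrite negbK => /eqP. Qed.

Lemma cone_link_coord D p : cone (link v D) p -> coord_at p v = 0.
Proof. by move=> [_]; rewrite !inE => /andP[]; rewrite negbK => /eqP. Qed.

(** A point with zero [v]-coordinate is supported in the deletion; otherwise, erasing that
    coordinate leaves a point over the link. Both pieces are closed, so maps on the cone can be
    pasted from them. *)
Lemma cone_deletion_link D : down_closed D ->
  cone D = cone (deletion v D) `|` star_cone D.
Proof.
move=> dD; apply/seteqP; split=> p.
  move=> [p0 pD]; case: (eqVneq (coord_at p v) 0) => pv; [left|right].
    by split => //; rewrite !inE pD pv eqxx.
  split => //; split=> [u|]; first by rewrite coord_at_set; case: eqP.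
  by rewrite support_at_set0 !inE eqxx /= finset.setD1K ?inE.
move=> [[p0]|[pv [p0]]].
  by rewrite inE => /andP[pD _]; split.
rewrite support_at_set0 inE => /andP[_ pD]; split=> [u|].
  by have := p0 u; rewrite coord_at_set; case: eqP => // ->.
apply: dD pD _; apply/fintype.subsetP => u; rewrite !inE => ->.
by case: eqP.
Qed.

Lemma star_cone_set_coord D q t :
  cone (link v D) q -> 0 <= t -> star_cone D (set_coord v q t).
Proof.
move=> Lq t0; split; first by rewrite coord_at_set eqxx.
by rewrite set_coord_set set_coord_id// (cone_link_coord Lq).
Qed.

Lemma star_coneZ D c p : 0 < c -> star_cone D p -> star_cone D (c *: p).
Proof.
move=> c0 [pv Lp]; split; first by rewrite coord_atZ mulr_ge0// ltW.
by rewrite -[0](mulr0 c) set_coordZ; exact: coneZ.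
Qed.

(** The deletion fills the upper half-space and the link is its bounding hyperplane. The star is the
    link times a half-line, and it fills the lower half-space once the [v]-coordinate is used as
    negative height. *)
Lemma conical_sphere_glue D : down_closed D ->
  conical_ball R (deletion v D) (link v D) -> conical_sphere R D.
Proof.
move=> dD [m [f [g [[cf cg] fP gP fZ fB]]]].
have sLd := link_sub_deletion dD.
have fL p : cone (link v D) p -> (f p).2 = 0.
  by move=> Lp; apply/eqP; rewrite fB; [case: Lp|exact: cone_sub Lp].
pose F p := if coord_at p v == 0 then snoc (f p).1 (f p).2
            else snoc (f (set_coord v p 0)).1 (- coord_at p v).
pose G (z : 'rV[R]_(m + 1)) :=
  if 0 <= last_coord z then g (lsubmx z, last_coord z)
  else set_coord v (g (lsubmx z, 0)) (- last_coord z).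
have Fdel p : cone (deletion v D) p -> F p = snoc (f p).1 (f p).2.
  by move=> dp; rewrite /F (cone_deletion_coord dp) eqxx.
have Fstar p : star_cone D p ->
    F p = snoc (f (set_coord v p 0)).1 (- coord_at p v).
  move=> [_ Lp]; rewrite /F; case: eqP => // pv; move: Lp.
  by rewrite set_coord_id// => Lp; rewrite fL// pv oppr0.
have Gge z : 0 <= last_coord z -> G z = g (lsubmx z, last_coord z).
  by rewrite /G => ->.
have g0L x : cone (link v D) (g (x, 0)).
  have [dg fg] := gP (x, 0) (lexx 0).
  by split; [case: dg|rewrite -fB// fg/= eqxx].
(* The two formulas for [G] agree at height zero, since [g (x, 0)] lies over the link and has zero
   [v]-coordinate. *)
have Gle z : last_coord z <= 0 ->
    G z = set_coord v (g (lsubmx z, 0)) (- last_coord z).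
  rewrite /G; case: (leP 0 (last_coord z)) => // z0 z1.
  have -> : last_coord z = 0 by apply/eqP; rewrite eq_le z0 z1.
  by rewrite oppr0 set_coord_id// (cone_link_coord (g0L _)).
exists (m + 1)%N, F, G; split.
- split.
    rewrite cone_deletion_link//; apply: continuous_on_paste.
    + exact/closed_cone/down_closed_deletion.
    + exact: closed_star_cone.
    + apply: continuous_on_eq (fun p dp => esym (Fdel p dp)) _.
      apply: continuous_on_snoc; first exact: continuous_on_fst.
      exact: continuous_on_snd.
    + apply: continuous_on_eq (fun p sp => esym (Fstar p sp)) _.
      apply: continuous_on_snoc.
        apply: continuous_on_fst.
        apply: (continuous_on_comp (B := cone (deletion v D)) _ _ cf).
          apply: continuous_on_set_coord; first exact: continuous_on_id.
          exact: continuous_on_cst.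
        by move=> p [_]; exact: cone_sub.
      apply/continuous_onN/continuous_on_coord_at; exact: continuous_on_id.
  apply: continuous_onT.
  have -> : [set: 'rV[R]_(m + 1)] =
      [set z | 0 <= last_coord z] `|` [set z | last_coord z <= 0].
    by apply/seteqP; split => // z _ /=; exact/orP/le_total.
  have clast : continuous (@last_coord R m).
    by apply: continuous_onT; apply: continuous_on_last_coord; exact: continuous_on_id.
  apply: continuous_on_paste.
  + exact: (closed_preimage clast (@closed_ge _ 0)).
  + exact: (closed_preimage clast (@closed_le _ 0)).
  + apply: continuous_on_eq (fun z dz => esym (Gge z dz)) _.
    apply: (continuous_on_comp (B := @halfspace R m) _ _ cg) => //.
    apply: continuous_on_pair.
      apply: continuous_on_lsubmx; exact: continuous_on_id.
    exact: continuous_continuous_on.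
  + apply: continuous_on_eq (fun z dz => esym (Gle z dz)) _.
    apply: continuous_on_set_coord; last first.
      apply: continuous_onN; exact: continuous_continuous_on.
    apply: (continuous_on_comp (B := @halfspace R m) _ _ cg) => //.
      apply: continuous_on_pair; last exact: continuous_on_cst.
      apply: continuous_on_lsubmx; exact: continuous_on_id.
    by move=> z _; rewrite /halfspace /=.
- move=> p; rewrite cone_deletion_link// => -[dp|sp].
    have [f0 fK] := fP _ dp.
    rewrite Fdel// Gge; last by rewrite last_coord_snoc.
    by rewrite last_coord_snoc snocK -surjective_pairing.
  have [p0 Lp] := sp.
  have [_ fK] := fP _ (cone_sub sLd Lp).
  rewrite Fstar// Gle; last by rewrite last_coord_snoc oppr_le0.
  rewrite last_coord_snoc snocK opprK -{2}(fL _ Lp) -surjective_pairing fK.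
  by rewrite set_coord_set set_coord_id.
- move=> z; rewrite cone_deletion_link//.
  case: (leP 0 (last_coord z)) => z0.
    have [dg fg] := gP (lsubmx z, last_coord z) z0.
    by rewrite Gge//; split; [left|rewrite Fdel// fg snoc_last].
  have [dg fg] := gP (lsubmx z, 0) (lexx 0).
  rewrite Gle ?ltW//.
  have sg : star_cone D (set_coord v (g (lsubmx z, 0)) (- last_coord z)).
    by apply: star_cone_set_coord => //; rewrite oppr_ge0 ltW.
  split; first by right.
  rewrite Fstar// set_coord_set coord_at_set eqxx opprK set_coord_id.
    by rewrite fg snoc_last.
  exact: cone_deletion_coord dg.
- move=> c p c0; rewrite cone_deletion_link// => -[dp|sp].
    by rewrite !Fdel ?fZ//=; [exact: snocZ|exact: coneZ].
  have [p0 Lp] := sp.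
  rewrite !Fstar//; last exact: star_coneZ.
  rewrite -{1}[0](mulr0 c) set_coordZ coord_atZ fZ//=; last exact: cone_sub Lp.
  by rewrite -mulrN snocZ.
Qed.

(* Write [(x, r)] and [(y, u)] for the charts of the deletion and of the link,
   and let [h] be the height [u] transported to the boundary of the deletion,
   extended by zero off the link. The wedge [0 <= t], [0 <= u] over the link is
   sheared onto the region between the graphs of [-h] and [0], so the union is
   the region [r >= - h x], straightened by [r |-> r + h x]. *)
Lemma conical_ball_glue D BL M : down_closed D -> down_closed M ->
  M \subset deletion v D -> BL \subset link v D ->
  (link v D :&: M)%SET \subset BL ->
  conical_ball R (deletion v D) (link v D :|: M)%SET ->
  conical_ball R (link v D) BL ->
  conical_ball R D (M :|: [set C : {set V} | (C :\ v)%SET \in BL])%SET.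
Proof.
move=> dD dM /fintype.subsetP sMd /fintype.subsetP sBL /fintype.subsetP sLM.
move=> [m [f [g [[cf cg] fP gP fZ fB]]]] [n [f' [g' [[cf' cg'] fP' gP' fZ' fB']]]].
set L := link v D in sBL sLM fB cf' fP' gP' fZ' fB' *.
set del := deletion v D in cf fP gP fZ fB *.
have sLd : L \subset del := link_sub_deletion dD.
have Ld p : cone L p -> cone del p by exact: cone_sub.
have fL p : cone L p -> (f p).2 = 0.
  by move=> Lp; apply/eqP; rewrite fB; [rewrite inE; case: Lp => _ ->|exact: Ld].
have f'LM p : cone L p -> support_at p \in M -> (f' p).2 = 0.
  by move=> Lp Mp; apply/eqP; rewrite fB'//; apply: sLM; rewrite inE Mp; case: Lp => _ ->.
pose h x := if support_at (g (x, 0)) \in L then (f' (g (x, 0))).2 else 0.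
have g0 x : cone del (g (x, 0)) /\ f (g (x, 0)) = (x, 0) := gP (x, 0) (lexx 0).
have hL x : cone L (g (x, 0)) -> h x = (f' (g (x, 0))).2.
  by move=> [_ gL]; rewrite /h gL.
have h_ge0 x : 0 <= h x.
  rewrite /h; case: ifP => // gL; have [] // := fP' (g (x, 0)).
  by split => //; case: (g0 x) => -[].
have hLf p : cone L p -> h (f p).1 = (f' p).2.
  move=> Lp; have [_ gf] := fP _ (Ld _ Lp).
  have e : g ((f p).1, 0) = p by rewrite -(fL _ Lp) -surjective_pairing.
  by rewrite hL e.
(* Each [g (x, 0)] is a boundary point of the deletion, so its support is in the link or in [M]. On
   the first closed piece [h] is the height in the link, on the second it is zero; they agree
   because link faces in [M] lie in [BL]. *)
have ch : continuous h.
  have cg0 : continuous (fun x => g (x, 0)).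
    apply: continuous_onT; apply: (continuous_on_comp (B := @halfspace R m) _ _ cg).
      apply: continuous_on_pair; [exact: continuous_on_id|exact: continuous_on_cst].
    by move=> x _; rewrite /halfspace /=.
  apply: continuous_onT.
  have -> : setT = (fun x => g (x, 0)) @^-1` cone L `|` (fun x => g (x, 0)) @^-1` cone M.
    apply/seteqP; split => // x _; have [dg fg] := g0 x.
    have := fB _ dg; rewrite fg eqxx => /esym; rewrite inE => /orP[gL|gM].
      by left; split => //; case: dg.
    by right; split => //; case: dg.
  apply: continuous_on_paste.
  + apply: closed_preimage => //; exact/closed_cone/down_closed_link.
  + apply: closed_preimage => //; exact/closed_cone.
  + apply: (@continuous_on_eq _ _ _ (fun x => (f' (g (x, 0))).2)) => [x Lx|].
      by rewrite hL.
    apply: continuous_on_snd; apply: (continuous_on_comp (B := cone L) _ _ cf') => //.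
    exact: continuous_continuous_on.
  + apply: (@continuous_on_eq _ _ _ (fun=> 0)); last exact: continuous_on_cst.
    move=> x [gx0 Mx]; rewrite /h; case: ifP => // Lx.
    by rewrite f'LM.
(* Let a star point have link chart [(y, u)] and [v]-coordinate [t]. Then [a_ p] is the link point
   with chart [(y, u + t)]; if it sits at [x], then [h x = u + t], so the sheared height [- t]
   straightens to [u]. Conversely [b_] keeps the link position of [g (x, 0)] and lowers its height
   from [h x] to [w], the difference being the [v]-coordinate. *)
pose q_ p := set_coord v p 0.
pose a_ p := g' ((f' (q_ p)).1, (f' (q_ p)).2 + coord_at p v).
pose F p := if coord_at p v == 0 then ((f p).1, (f p).2 + h (f p).1)
            else ((f (a_ p)).1, (f' (q_ p)).2).
pose b_ (z : 'rV[R]_m * R) := g' ((f' (g (z.1, 0))).1, z.2).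
pose G (z : 'rV[R]_m * R) := if h z.1 <= z.2 then g (z.1, z.2 - h z.1)
  else set_coord v (b_ z) (h z.1 - z.2).
have Lq p : star_cone D p -> cone L (q_ p) by case.
have a_ge0 p : star_cone D p -> 0 <= (f' (q_ p)).2 + coord_at p v.
  by move=> sp; apply: addr_ge0; [case: (fP' _ (Lq _ sp))|case: sp].
have aP p : star_cone D p -> cone L (a_ p) /\
    f' (a_ p) = ((f' (q_ p)).1, (f' (q_ p)).2 + coord_at p v).
  by move=> sp; apply: gP'; exact: a_ge0.
have Fdel p : cone del p -> F p = ((f p).1, (f p).2 + h (f p).1).
  by move=> dp; rewrite /F (cone_deletion_coord dp) eqxx.
have Fstar p : star_cone D p -> F p = ((f (a_ p)).1, (f' (q_ p)).2).
  move=> sp; rewrite /F; case: eqP => // pv.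
  have qp : q_ p = p by rewrite /q_ set_coord_id.
  have Lp : cone L p by rewrite -qp; exact: Lq.
  have [_ gf'] := fP' _ Lp.
  by rewrite /a_ qp pv addr0 -surjective_pairing gf' fL// add0r hLf.
have hpos x : 0 < h x -> cone L (g (x, 0)).
  move=> hx; split; first by case: (g0 x) => -[].
  by apply: contraTT hx => /negbTE gL; rewrite /h gL ltxx.
have Gge z : h z.1 <= z.2 -> G z = g (z.1, z.2 - h z.1) by rewrite /G => ->.
have bP z : 0 <= z.2 -> cone L (b_ z) /\ f' (b_ z) = ((f' (g (z.1, 0))).1, z.2).
  by move=> z0; exact: (gP' (_, _) z0).
have Gle z : 0 <= z.2 -> z.2 <= h z.1 -> cone L (g (z.1, 0)) ->
    G z = set_coord v (b_ z) (h z.1 - z.2).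
  rewrite /G; case: (leP (h z.1) z.2) => // hz z0 zh Lg.
  have e : h z.1 = z.2 by apply/eqP; rewrite eq_le hz zh.
  rewrite e subrr set_coord_id; last exact: cone_link_coord (proj1 (bP _ z0)).
  rewrite /b_ -e hL// -surjective_pairing.
  by case: (fP' _ Lg).
exists m, F, G; split.
- split.
    rewrite cone_deletion_link//; apply: continuous_on_paste.
    + exact/closed_cone/down_closed_deletion.
    + exact: closed_star_cone.
    + apply: continuous_on_eq (fun p dp => esym (Fdel p dp)) _.
      have cf1 := continuous_on_fst cf.
      apply: continuous_on_pair => //; apply: continuous_onD.
        exact: continuous_on_snd.
      exact: continuous_on_compT.
    + apply: continuous_on_eq (fun p sp => esym (Fstar p sp)) _.
      have cq : continuous_on (star_cone D) (fun p => f' (q_ p)).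
        apply: (continuous_on_comp (B := cone L) _ _ cf') => //.
        apply: continuous_on_set_coord; first exact: continuous_on_id.
        exact: continuous_on_cst.
      apply: continuous_on_pair; last exact: continuous_on_snd.
      apply: continuous_on_fst.
      apply: (continuous_on_comp (B := cone del) _ _ cf) => [|p sp]; last first.
        by apply: Ld; exact: (proj1 (aP p sp)).
      apply: (continuous_on_comp (B := @halfspace R n) _ _ cg') => //.
      apply: continuous_on_pair; first exact: continuous_on_fst.
      apply: continuous_onD; first exact: continuous_on_snd.
      apply: continuous_on_coord_at; exact: continuous_on_id.
  have c1 : continuous (fun z : 'rV[R]_m * R => z.1) by move=> z; exact: cvg_fst.
  have c2 : continuous (fun z : 'rV[R]_m * R => z.2) by move=> z; exact: cvg_snd.
  have c1' A := continuous_continuous_on (A := A) c1.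
  have c2' A := continuous_continuous_on (A := A) c2.
  have ch1 A : continuous_on A (fun z : 'rV[R]_m * R => h z.1).
    exact: continuous_on_compT (c1' A) ch.
  have cg01 A : continuous_on A (fun z : 'rV[R]_m * R => g (z.1, 0)).
    apply: (continuous_on_comp (B := @halfspace R m) _ _ cg).
      apply: continuous_on_pair => //; exact: continuous_on_cst.
    by move=> z _; rewrite /halfspace /=.
  have cdiff : continuous (fun z : 'rV[R]_m * R => z.2 - h z.1).
    by apply: continuous_onT; apply: continuous_onB.
  (* [H2] also demands that [g (z.1, 0)] lie over the link, where [f'] is known to be continuous.
     The half-space is still covered: below the graph of [h] the value [h z.1] is positive, which
     forces this condition. *)
  pose H1 := [set z : 'rV[R]_m * R | 0 <= z.2 - h z.1].
  pose H2 := [set z : 'rV[R]_m * R | 0 <= z.2] `&`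
    ([set z : 'rV[R]_m * R | z.2 - h z.1 <= 0] `&`
    (fun z : 'rV[R]_m * R => g (z.1, 0)) @^-1` cone L).
  apply: (@continuous_on_subset _ _ _ (H1 `|` H2)) => [z z0|].
    case: (leP 0 (z.2 - h z.1)) => zh; [by left|right].
    split => //; split; first exact: ltW.
    by apply: hpos; apply: le_lt_trans z0 _; rewrite -subr_lt0.
  apply: continuous_on_paste.
  + exact: (closed_preimage cdiff (@closed_ge _ 0)).
  + apply: closedI; first exact: (closed_preimage c2 (@closed_ge _ 0)).
    apply: closedI; first exact: (closed_preimage cdiff (@closed_le _ 0)).
    apply: closed_preimage; first exact: continuous_onT.
    exact/closed_cone/down_closed_link.
  + apply: (@continuous_on_eq _ _ _ (fun z => g (z.1, z.2 - h z.1))) => [z|].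
      by rewrite /H1 /= subr_ge0 => /Gge.
    apply: (continuous_on_comp (B := @halfspace R m) _ _ cg) => //.
    by apply: continuous_on_pair => //; exact: continuous_onB.
  + apply: (@continuous_on_eq _ _ _ (fun z => set_coord v (b_ z) (h z.1 - z.2))).
      by move=> z [z0 [zh Lz]]; rewrite Gle// -subr_le0.
    apply: continuous_on_set_coord; last exact: continuous_onB.
    apply: (continuous_on_comp (B := @halfspace R n) _ _ cg') => [|z []//].
    apply: continuous_on_pair => //; apply: continuous_on_fst.
    by apply: (continuous_on_comp (B := cone L) _ _ cf') => // z [_ []].
- move=> p; rewrite cone_deletion_link// => -[dp|sp].
    have [f0 fK] := fP _ dp; rewrite Fdel//; split.
      by rewrite /halfspace /= addr_ge0.
    rewrite Gge/= ?lerDr//; first by rewrite addrK -surjective_pairing.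
  have [p0 _] := sp; have [La fa] := aP p sp.
  have [f0 fK] := fP' _ (Lq _ sp).
  rewrite Fstar//; split => //.
  have ga : g ((f (a_ p)).1, 0) = a_ p.
    by rewrite -(fL _ La) -surjective_pairing; case: (fP _ (Ld _ La)).
  rewrite Gle//= ?ga//; last by rewrite hLf// fa /= lerDl.
  rewrite hLf// fa /= addrC addKr /b_ /= ga fa /= -surjective_pairing fK.
  by rewrite set_coord_set set_coord_id.
- move=> [x w] /= w0; rewrite cone_deletion_link//.
  case: (leP (h x) w) => hw.
    have [dg fg] := gP (x, w - h x) (etrans (subr_ge0 _ _) hw).
    by rewrite Gge//=; split; [left|rewrite Fdel// fg/= subrK].
  have Lg : cone L (g (x, 0)) by apply: hpos; exact: le_lt_trans hw.
  have [Lb fb] := bP (x, w) w0.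
  have [_ fg] := g0 x.
  rewrite Gle//=; last exact: ltW.
  have sg : star_cone D (set_coord v (b_ (x, w)) (h x - w)).
    by apply: star_cone_set_coord => //; rewrite subr_ge0 ltW.
  split; first by right.
  rewrite Fstar// /a_ /q_ set_coord_set coord_at_set eqxx set_coord_id; last first.
    exact: cone_link_coord Lb.
  rewrite fb /= addrC subrK hL// -surjective_pairing.
  by rewrite (proj2 (fP' _ Lg)) fg.
(* Homogeneity is assumed of the charts only; their inverses inherit it. *)
- have gZ c z : 0 < c -> halfspace z -> g (c *: z.1, c * z.2) = c *: g z.
    move=> c0 z0; have [dg fg] := gP z z0.
    have [_ <-] := fP _ (coneZ c0 dg).
    by rewrite fZ// fg.
  have gZ' c z : 0 < c -> halfspace z -> g' (c *: z.1, c * z.2) = c *: g' z.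
    move=> c0 z0; have [dg fg] := gP' z z0.
    have [_ <-] := fP' _ (coneZ c0 dg).
    by rewrite fZ'// fg.
  have hZ c x : 0 < c -> h (c *: x) = c * h x.
    move=> c0; have e : g (c *: x, 0) = c *: g (x, 0).
      by rewrite -gZ//= ?mulr0// /halfspace /=.
    rewrite /h e support_atZ ?gt_eqF//; case: ifP => Lx; last by rewrite mulr0.
    by rewrite fZ'//; split => //; case: (g0 x) => -[].
  move=> c p c0; rewrite cone_deletion_link// => -[dp|sp].
    by rewrite !Fdel ?fZ//=; [rewrite hZ// mulrDr|exact: coneZ].
  have [La fa] := aP p sp.
  rewrite !Fstar//; last exact: star_coneZ.
  have qZ : q_ (c *: p) = c *: q_ p by rewrite /q_ -{1}[0](mulr0 c) set_coordZ.
  have aZ : a_ (c *: p) = c *: a_ p.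
    rewrite /a_ qZ coord_atZ fZ'//=; last exact: Lq.
    rewrite -mulrDr -gZ'//; exact: a_ge0.
  by rewrite aZ qZ fZ// ?fZ'//; [exact: Lq|exact: Ld].
(* On the deletion the new height is a sum of two nonnegative terms. Over a link face it vanishes
   exactly on [BL], and off the link exactly on [M]. On the star it is the height [u], which
   vanishes when the face without [v] is in [BL]. *)
- move=> p; rewrite cone_deletion_link// => -[dp|sp].
    have [f0 fK] := fP _ dp.
    have vp : (support_at p :\ v)%SET = support_at p.
      apply/setP => u; rewrite !inE; case: eqP => // ->.
      by rewrite (cone_deletion_coord dp) eqxx.
    rewrite Fdel//= paddr_eq0// fB// 2!finset.in_setU [X in _ = _ || X]inE vp.
    case: (boolP (support_at p \in L)) => pL /=.
      have Lp : cone L p by split => //; case: dp.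
      rewrite hLf// fB'//; case: (boolP (support_at p \in M)) => //= pM.
      by have := sLM (support_at p); rewrite finset.in_setI pL pM => ->.
    case: (boolP (support_at p \in M)) => pM /=; last first.
      by apply/esym/negbTE; apply: contra pL; exact: sBL.
    rewrite /h; case: ifP => [gL|]; last by rewrite eqxx.
    have p2 : (f p).2 = 0 by apply/eqP; rewrite fB// inE pM orbT.
    have e : g ((f p).1, 0) = p by rewrite -p2 -surjective_pairing.
    by move: gL; rewrite e (negbTE pL).
  rewrite Fstar//= fB'; last exact: Lq.
  rewrite /q_ support_at_set0 finset.in_setU [X in _ = _ || X]inE.
  case: (boolP (support_at p \in M)) => //= pM; apply: sLM.
  have [p0 Lp] := sp.
  have vp : coord_at p v = 0.
    by have := sMd _ pM; rewrite !inE negbK => /andP[_ /eqP].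
  by rewrite -support_at_set0 set_coord_id// inE pM andbT; move: Lp; rewrite set_coord_id// => -[].
Qed.

End Gluing.

(** * From conical charts to balls and spheres *)

Section Normalization.
Variable R : realType.

Definition sqnorm m (x : 'rV[R]_m) : R := \sum_i x 0 i ^+ 2.

Lemma sqnorm_ge0 m (x : 'rV[R]_m) : 0 <= sqnorm x.
Proof. by apply: sumr_ge0 => i _; exact: sqr_ge0. Qed.

Lemma sqnorm_eq0 m (x : 'rV[R]_m) : (sqnorm x == 0) = (x == 0).
Proof.
rewrite psumr_eq0 => [|i _]; last exact: sqr_ge0.
apply/allP/eqP => [x0|-> i _]; last by rewrite mxE expr0n eqxx.
apply/rowP => i; have := x0 i (mem_index_enum _).
by rewrite sqrf_eq0 mxE => /eqP.
Qed.

Lemma sqnormZ m c (x : 'rV[R]_m) : sqnorm (c *: x) = c ^+ 2 * sqnorm x.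
Proof. by rewrite mulr_sumr; apply: eq_bigr => i _; rewrite mxE exprMn. Qed.

Lemma continuous_on_sqnorm (S : topologicalType) (A : set S) m (f : S -> 'rV[R]_m) :
  continuous_on A f -> continuous_on A (fun x => sqnorm (f x)).
Proof.
move=> cf; apply: continuous_on_sum => i; apply: continuous_on_sqr.
exact: continuous_on_coord.
Qed.

Definition mass m (x : 'rV[R]_m) : R := \sum_i x 0 i.

Lemma massZ m c (x : 'rV[R]_m) : mass (c *: x) = c * mass x.
Proof. by rewrite mulr_sumr; apply: eq_bigr => i _; rewrite mxE. Qed.

Lemma continuous_on_mass (S : topologicalType) (A : set S) m (f : S -> 'rV[R]_m) :
  continuous_on A f -> continuous_on A (fun x => mass (f x)).
Proof. by move=> cf; apply: continuous_on_sum => i; exact: continuous_on_coord. Qed.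

Variables (V : finType) (D : {set {set V}}).
Local Notation vec := 'rV[R]_#|V|.

Lemma realizationE (p : vec) : realization R D p <-> cone D p /\ mass p = 1.
Proof.
split=> [[p0 p1 pD]|[[p0 pD] p1]]; first by split => //; split => // u; exact: p0.
by split => // i; have := p0 (enum_val i); rewrite /coord_at enum_valK.
Qed.

Lemma mass_gt0 (p : vec) : cone D p -> p != 0 -> 0 < mass p.
Proof.
move=> [p0 _] pn0.
have p0' i : 0 <= p 0 i by have := p0 (enum_val i); rewrite /coord_at enum_valK.
rewrite lt_neqAle eq_sym sumr_ge0// andbT; apply: contra pn0.
rewrite psumr_eq0// => /allP mp; apply/eqP/rowP => i; rewrite mxE.
exact/eqP/(mp i (mem_index_enum _)).
Qed.

Lemma realization_normalize (p : vec) :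
  cone D p -> p != 0 -> realization R D ((mass p)^-1 *: p).
Proof.
move=> Dp pn0; have m0 := mass_gt0 Dp pn0; apply/realizationE; split.
  by apply: coneZ => //; rewrite invr_gt0.
by rewrite massZ mulVf// gt_eqF.
Qed.

Lemma realization_neq0 (p : vec) : realization R D p -> p != 0.
Proof.
move=> /realizationE[_ p1]; apply: contraTneq isT => p0; move/eqP: p1.
by rewrite p0 /mass big1 ?(eq_sym 0) ?oner_eq0// => i _; rewrite mxE.
Qed.

Lemma sqrt_gt0 (r : R) : 0 <= r -> r != 0 -> 0 < Num.sqrt r.
Proof. by move=> r0 rn0; rewrite sqrtr_gt0 lt_neqAle eq_sym rn0. Qed.

Hypothesis D0 : finset.set0 \in D.

Lemma cone0 : cone D (0 : vec).
Proof.
split=> [u|]; first by rewrite /coord_at mxE.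
rewrite (_ : support_at _ = finset.set0)//; apply/setP => u.
by rewrite !inE /coord_at mxE eqxx.
Qed.

(** The realization is the slice of the cone at mass one and meets each ray once, as the unit sphere
    does in [R^m]. A homogeneous chart carries rays to rays, so rescaling it gives the
    homeomorphism. *)
Lemma conical_sphere_homeomorphic : conical_sphere R D ->
  exists n, homeomorphic (set_type (realization R D)) (set_type (unit_sphere R n)).
Proof.
move=> [m [f [g [[cf cg] fK gK fZ]]]]; exists m.
(* Homogeneity at the origin with factor 2 gives [f 0 = 2 *: f 0]. *)
have f0 : f 0 = 0.
  have := fZ 2 0 (ltr0Sn _ 1) cone0; rewrite scaler0 -[2]/(1 + 1) scalerDl scale1r.
  by move=> /esym/eqP; rewrite -subr_eq0 addrK => /eqP.
have fn0 p : realization R D p -> f p != 0.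
  move=> Dp; apply: contra (realization_neq0 Dp) => /eqP fp.
  have [Cp _] := (realizationE p).1 Dp.
  by rewrite -(fK _ Cp) fp -f0 fK//; exact: cone0.
have gn0 z : unit_sphere R m z -> g z != 0.
  move=> z1; apply: contraTneq isT => g0.
  have [_ gz] := gK z; move: z1; rewrite -gz g0 f0 /unit_sphere /=.
  by rewrite big1 => [/eqP|i _]; rewrite ?(eq_sym 0) ?oner_eq0// mxE expr0n.
pose N p := Num.sqrt (sqnorm (f p)).
have N0 p : realization R D p -> 0 < N p.
  by move=> /fn0 fp; rewrite sqrt_gt0 ?sqnorm_ge0 ?sqnorm_eq0.
have Nsq p : realization R D p -> N p ^+ 2 = sqnorm (f p).
  by move=> Dp; rewrite sqr_sqrtr// sqnorm_ge0.
apply: (@homeomorphic_set_type _ _ _ _ (fun p => (N p)^-1 *: f p)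
  (fun z => (mass (g z))^-1 *: g z)).
- have cfr : continuous_on (realization R D) f.
    by apply: continuous_on_subset cf => p /realizationE[].
  apply: continuous_onZ => //; apply: continuous_onV => [p /N0/gt_eqF->//|].
  by apply: continuous_on_sqrt; exact: continuous_on_sqnorm.
- have cg' := continuous_continuous_on (A := unit_sphere R m) cg.
  apply: continuous_onZ => //; apply: continuous_onV; last exact: continuous_on_mass.
  by move=> z /gn0 gz; rewrite gt_eqF// mass_gt0//; case: (gK z).
- move=> p Dp; rewrite /unit_sphere /= -/(sqnorm _) sqnormZ exprVn Nsq//.
  by rewrite mulVf// sqnorm_eq0 fn0.
- by move=> z /gn0 gz; apply: realization_normalize => //; case: (gK z).
- move=> p Dp; have /realizationE[Cp p1] := Dp.
  have e : g ((N p)^-1 *: f p) = (N p)^-1 *: p.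
    have Np : 0 < (N p)^-1 by rewrite invr_gt0 N0.
    by rewrite -fZ// fK//; exact: coneZ.
  by rewrite e massZ p1 mulr1 invrK scalerA divff ?scale1r// gt_eqF// N0.
- move=> z z1; have [Cg fg] := gK z; have gz := gn0 _ z1.
  have m0 : 0 < (mass (g z))^-1 by rewrite invr_gt0 (mass_gt0 Cg).
  rewrite /N fZ// fg sqnormZ (_ : sqnorm z = 1)// mulr1 sqrtr_sqr gtr0_norm//.
  by rewrite scalerA mulVf ?scale1r// gt_eqF.
Qed.

(* The half-space meets the unit sphere in a hemisphere, which projects onto
   the equatorial ball. *)
Lemma conical_ball_homeomorphic B : conical_ball R D B ->
  exists n, homeomorphic (set_type (realization R D)) (set_type (unit_ball R n)).
Proof.
move=> [m [f [g [[cf cg] fP gP fZ _]]]]; exists m.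
have f0 : f 0 = (0, 0).
  have := fZ 2 0 (ltr0Sn _ 1) cone0; rewrite scaler0.
  case: (f 0) => x r /= [ex er]; congr pair; last by lra.
  move/eqP: ex; rewrite -[2]/(1 + 1) scalerDl scale1r -subr_eq0 opprD addrA subrr.
  by rewrite add0r oppr_eq0 => /eqP.
pose N p := Num.sqrt (sqnorm (f p).1 + (f p).2 ^+ 2).
have N2_ge0 p : 0 <= sqnorm (f p).1 + (f p).2 ^+ 2.
  by rewrite addr_ge0 ?sqnorm_ge0 ?sqr_ge0.
have N0 p : realization R D p -> 0 < N p.
  move=> Dp; rewrite sqrt_gt0//; apply: contra (realization_neq0 Dp).
  rewrite paddr_eq0 ?sqnorm_ge0 ?sqr_ge0// sqnorm_eq0 sqrf_eq0.
  move=> /andP[/eqP x0 /eqP r0]; have [Cp _] := (realizationE p).1 Dp.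
  have [_ <-] := fP _ Cp; rewrite [f p]surjective_pairing x0 r0 -f0.
  by rewrite (proj2 (fP _ cone0)).
have Nsq p : N p ^+ 2 = sqnorm (f p).1 + (f p).2 ^+ 2 by rewrite sqr_sqrtr.
(* The height of the point of the unit hemisphere above [x]. *)
pose s (x : 'rV[R]_m) := Num.sqrt (1 - sqnorm x).
have xs0 x : halfspace (x, s x) by exact: sqrtr_ge0.
have ssq x : unit_ball R m x -> sqnorm x + s x ^+ 2 = 1.
  by move=> x1; rewrite sqr_sqrtr ?subr_ge0// addrC subrK.
have gn0 x : unit_ball R m x -> g (x, s x) != 0.
  move=> x1; apply: contraTneq isT => g0.
  have [_ gx] := gP _ (xs0 x); move: gx; rewrite g0 f0 => -[ex es].
  have := ssq _ x1; rewrite -es -ex expr0n addr0 => /eqP.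
  by rewrite (eqP (_ : sqnorm 0 == 0)) ?sqnorm_eq0 ?eqxx// eq_sym oner_eq0.
apply: (@homeomorphic_set_type _ _ _ _ (fun p => (N p)^-1 *: (f p).1)
  (fun x => (mass (g (x, s x)))^-1 *: g (x, s x))).
- have cfr : continuous_on (realization R D) f.
    by apply: continuous_on_subset cf => p /realizationE[].
  have cfr1 := continuous_on_fst cfr.
  apply: continuous_onZ => //; apply: continuous_onV => [p /N0/gt_eqF->//|].
  apply: continuous_on_sqrt; apply: continuous_onD; first exact: continuous_on_sqnorm.
  by apply: continuous_on_sqr; exact: continuous_on_snd.
- have cgs : continuous_on (unit_ball R m) (fun x => g (x, s x)).
    apply: (continuous_on_comp (B := @halfspace R m) _ _ cg) => //.
    apply: continuous_on_pair; first exact: continuous_on_id.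
    apply: continuous_on_sqrt; apply: continuous_onB; first exact: continuous_on_cst.
    apply: continuous_on_sqnorm; exact: continuous_on_id.
  apply: continuous_onZ => //; apply: continuous_onV; last exact: continuous_on_mass.
  by move=> x /gn0 gx; rewrite gt_eqF// mass_gt0//; case: (gP _ (xs0 x)).
- move=> p Dp; rewrite /unit_ball /= -/(sqnorm _) sqnormZ exprVn.
  rewrite mulrC ler_pdivrMr ?exprn_gt0 ?N0// mul1r Nsq lerDl.
  exact: sqr_ge0.
- by move=> x /gn0 gx; apply: realization_normalize => //; case: (gP _ (xs0 x)).
- move=> p Dp; have /realizationE[Cp p1] := Dp; have Np := N0 _ Dp.
  have [r0 gf] := fP _ Cp.
  have es : s ((N p)^-1 *: (f p).1) = (N p)^-1 * (f p).2.
    rewrite /s sqnormZ.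
    have -> : 1 - (N p)^-1 ^+ 2 * sqnorm (f p).1 = ((N p)^-1 * (f p).2) ^+ 2.
      rewrite exprMn -[sqnorm _](addrK ((f p).2 ^+ 2)) -Nsq mulrBr !exprVn.
      by rewrite mulVf ?expf_neq0 ?gt_eqF// opprB addrC subrK.
    by rewrite sqrtr_sqr ger0_norm// mulr_ge0// invr_ge0 ltW.
  have e : g ((N p)^-1 *: (f p).1, (N p)^-1 * (f p).2) = (N p)^-1 *: p.
    have Np' : 0 < (N p)^-1 by rewrite invr_gt0.
    by rewrite -fZ// (proj2 (fP _ (coneZ Np' Cp))).
  by rewrite es e massZ p1 mulr1 invrK scalerA divff ?scale1r// gt_eqF.
- move=> x x1; have [Cg fg] := gP _ (xs0 x); have gx := gn0 _ x1.
  have m0 : 0 < (mass (g (x, s x)))^-1 by rewrite invr_gt0 (mass_gt0 Cg).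
  rewrite /N fZ// fg /= sqnormZ exprMn -mulrDr ssq// mulr1 sqrtr_sqr gtr0_norm//.
  by rewrite scalerA mulVf ?scale1r// gt_eqF.
Qed.

End Normalization.

(** * Complexes of sheddable families of functions *)

Section Simplices.
Import mathcomp.boot.fintype mathcomp.boot.finset.
Local Open Scope set_scope.
Variables (R : realType) (V : finType).
Implicit Types (S C : {set V}) (D B : {set {set V}}).

(** A chart tests boundary membership only at supports of points of the cone, which are faces of
    [D]. *)
Lemma eq_conical_ball D B B' : {in D, B =i B'} ->
  conical_ball R D B -> conical_ball R D B'.
Proof.
move=> BB' [m [f [g [cfg fP gP fZ fB]]]]; exists m, f, g; split => // p Dp.
by rewrite fB// BB'//; case: Dp.
Qed.

(** The cone is the origin alone, that is, [R^0]. The corresponding sphere has dimension -1 and is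
    empty. *)
Lemma conical_sphere_powerset0 : conical_sphere R (powerset (set0 : {set V})).
Proof.
exists 0%N, (fun=> 0), (fun=> 0); split.
- by split; [|apply: continuous_onT]; exact: continuous_on_cst.
- move=> p [_]; rewrite powerset0 inE => /eqP p0; apply: coord_atP => u.
  move/setP/(_ u): p0; rewrite !inE => /negbFE/eqP ->.
  by rewrite /coord_at mxE.
- move=> z; split; last by rewrite [z]thinmx0.
  by apply: cone0; rewrite inE.
- by move=> c p _ _; rewrite scaler0.
Qed.

(** Induction by coning from a vertex [v]: a face is on the boundary of the cone when it misses [v]
    or restricts to a proper face of the opposite simplex, hence when it is proper. *)
Lemma conical_ball_simplex S : S != set0 ->
  conical_ball R (powerset S) [set C : {set V} | C \proper S].
Proof.
have [n] := ubnP #|S|; elim: n S => // n IHn S; rewrite ltnS => Sn Sn0.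
have [v vS] := set0Pn _ Sn0.
have [S0|S'n0] := eqVneq (S :\ v) set0.
  have -> : S = [set v] by rewrite -(setD1K vS) S0 setU0.
  apply: eq_conical_ball (conical_ball_vertex R v) => C _.
  rewrite !inE properEneq subset1; have [->|] := eqVneq C [set v]; last by [].
  by rewrite -cards_eq0 cards1.
have sub1 C : (C :\ v \subset S :\ v) = (C \subset S).
  rewrite subsetD1 !inE eqxx andbT; apply/idP/idP => CS; last first.
    exact: subset_trans (subD1set _ _) CS.
  apply/subsetP => u uC; have [->//|uv] := eqVneq u v.
  by apply: (subsetP CS); rewrite !inE uv.
have sS : (#|S :\ v| < n)%N by apply: leq_trans Sn; rewrite [X in (_ < X)%N](cardsD1 v) vS.
have vK C : C \in powerset (S :\ v) -> v \notin C.
  by rewrite inE subsetD1 => /andP[].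
have := conical_ball_cone vK (IHn _ sS S'n0).
have -> : [set C : {set V} | C :\ v \in powerset (S :\ v)] = powerset S.
  by apply/setP => C; rewrite !inE sub1.
apply: eq_conical_ball => C; rewrite !inE => CS; rewrite !properE sub1 CS /=.
have [vC|vC] := boolP (v \in C); last first.
  by rewrite orbT; apply/esym; apply: contra vC => /subsetP/(_ v vS).
rewrite orbF; congr (~~ _); apply/idP/idP => [SC|]; last exact: setSD.
by rewrite -(setD1K vS) -(setD1K vC); exact: setUS.
Qed.

End Simplices.

(** * Links, deletions and boundaries for families of functions *)

Section Sheddable.
Import mathcomp.boot.fintype mathcomp.boot.finset.
Local Open Scope set_scope.
Variables (X Y : finType).
Implicit Types (T : {set {ffun X -> Y}}) (f g : {ffun X -> Y}).

Definition set_value f x y : {ffun X -> Y} := [ffun z => if z == x then y else f z].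

(* The pair [(x, y)] is the shedding vertex: the two subfamilies give its link
   and its deletion. *)
Inductive sheddable : {set {ffun X -> Y}} -> Prop :=
| sheddable1 f : sheddable [set f]
| sheddable_step T x y :
    [set f in T | f x != y] != set0 ->
    (forall f, f \in T -> set_value f x y \in T) ->
    sheddable [set f in T | f x != y] ->
    sheddable [set f in T | f x == y] ->
    sheddable T.

(** [iota] names the vertex of a pair. Injectivity is asked only at vertices in [A0], because
    [tableau_vertex E p] is [E] itself for every pair outside [E]. *)
Variables (V : finType) (iota : X * Y -> V) (A0 : {set V}).
Hypothesis iota_inj : forall p q, iota p \in A0 -> iota p = iota q -> p = q.
Hypothesis iota_surj : forall u, u \in A0 -> exists p, u = iota p.
Implicit Types (A C : {set V}).

(** Dually, the set of pairs whose vertices are not in [C] contains the graph of [f]. *)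
Definition avoids C f := [forall x, iota (x, f x) \notin C].

Definition inside A f := [forall x, iota (x, f x) \in A].

(** The vertex set [A] is a parameter of its own because passing to a link removes the shedding
    vertex from it. *)
Definition family_complex T A : {set {set V}} :=
  [set C : {set V} | (C \subset A) && [exists f in T, avoids C f]].

Definition family_boundary T A : {set {set V}} :=
  [set C in family_complex T A | [exists g, [&& g \notin T, inside A g & avoids C g]]].

Lemma family_complexP T A C :
  reflect (C \subset A /\ exists2 f, f \in T & avoids C f) (C \in family_complex T A).
Proof.
rewrite inE; apply: (iffP andP) => -[CA].
  by move=> /exists_inP[f fT fC]; split => //; exists f.
by move=> [f fT fC]; split => //; apply/exists_inP; exists f.
Qed.

Lemma family_boundaryP T A C :
  reflect (C \in family_complex T A /\
           exists g, [/\ g \notin T, inside A g & avoids C g])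
          (C \in family_boundary T A).
Proof.
rewrite [X in reflect _ X]inE; apply: (iffP andP) => -[CA].
  by move=> /existsP[g /and3P[gT gA gC]]; split => //; exists g.
by move=> [g [gT gA gC]]; split => //; apply/existsP; exists g; apply/and3P.
Qed.

Lemma avoidsS C C' f : C \subset C' -> avoids C' f -> avoids C f.
Proof.
move=> /subsetP CC' /forallP fC'; apply/forallP => x; apply: contra (fC' x).
exact: CC'.
Qed.

Lemma down_closed_family_complex T A : down_closed (family_complex T A).
Proof.
move=> C C' /family_complexP[C'A [f fT fC']] CC'; apply/family_complexP.
by split; [exact: subset_trans C'A|exists f => //; exact: avoidsS fC'].
Qed.

Lemma set0_family_complex T A : T != set0 -> set0 \in family_complex T A.
Proof.
move=> /set0Pn[f fT]; apply/family_complexP; split; first exact: sub0set.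
by exists f => //; apply/forallP => x; rewrite inE.
Qed.

Lemma set_value_eq f x y : set_value f x y x = y.
Proof. by rewrite ffunE eqxx. Qed.

Lemma set_value_id f x y z : f x = y -> set_value (set_value f x z) x y = f.
Proof. by move=> <-; apply/ffunP => t; rewrite !ffunE; case: eqP => [->|]. Qed.

Lemma avoids_set_value C f x y :
  avoids C f -> iota (x, y) \notin C -> avoids C (set_value f x y).
Proof.
by move=> /forallP fC yC; apply/forallP => z; rewrite ffunE; case: eqP => [->|].
Qed.

Lemma inside_set_value A f x y :
  inside A f -> iota (x, y) \in A -> inside A (set_value f x y).
Proof.
by move=> /forallP fA yA; apply/forallP => z; rewrite ffunE; case: eqP => [->|].
Qed.

(** The sphere case: no function is left to witness a boundary face. *)
Definition full T A := forall g, inside A g -> g \in T.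

Definition image_of f : {set V} := [set iota (x, f x) | x : X].

Lemma mem_image_of f x : iota (x, f x) \in image_of f.
Proof. exact: imset_f. Qed.

Lemma family_complex1 f A : family_complex [set f] A = powerset (A :\: image_of f).
Proof.
apply/setP => C; rewrite [RHS]inE subsetD; apply/family_complexP/andP.
  move=> [CA [_ /set1P -> /forallP fC]]; split => //.
  rewrite disjoints_subset; apply/subsetP => u uC; rewrite inE.
  by apply: contraL uC => /imsetP[x _ ->].
move=> [CA dC]; split => //; exists f; first exact: set11.
apply/forallP => x; move: dC; rewrite disjoint_sym disjoints_subset.
by move=> /subsetP/(_ _ (mem_image_of f x)); rewrite inE.
Qed.

Section InAmbient.
Variables (A : {set V}).
Hypothesis sA : A \subset A0.

Lemma inside_inj f x p : inside A f -> iota (x, f x) = iota p -> (x, f x) = p.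
Proof. by move=> /forallP/(_ x)/(subsetP sA); exact: iota_inj. Qed.

(** A facet is the complement in [A] of the image of some [f], and that image has one vertex for
    each point of [X]. *)
Lemma pure_family_complex T : (forall f, f \in T -> inside A f) ->
  pure (family_complex T A).
Proof.
move=> TA.
suff cardC C : is_facet (family_complex T A) C -> #|C| = (#|A| - #|X|)%N.
  by move=> C C' /cardC-> /cardC->.
move=> [/family_complexP[CA [f fT fC]] Cmax].
have fA := TA f fT.
have <- : A :\: image_of f = C.
  apply: Cmax.
    apply/family_complexP; split; first exact: subsetDl.
    by exists f => //; apply/forallP => x; rewrite inE mem_image_of.
  apply/subsetP => u uC; rewrite inE (subsetP CA)// andbT.
  by apply: contraL uC => /imsetP[x _ ->]; move/forallP: fC.
rewrite cardsD (setIidPr _); last first.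
  by apply/subsetP => _ /imsetP[x _ ->]; move/forallP: fA.
rewrite card_imset// => x z xz.
by have [] := inside_inj fA xz.
Qed.

Variables (T : {set {ffun X -> Y}}) (x : X) (y : Y).
Hypothesis TA : forall f, f \in T -> inside A f.
Hypothesis Txy : forall f, f \in T -> set_value f x y \in T.
Let v := iota (x, y).
Let T1 := [set f in T | f x != y].
Let T2 := [set f in T | f x == y].
Hypothesis T1n0 : T1 != set0.

Lemma inside_setD1 f : inside A f -> f x != y -> inside (A :\ v) f.
Proof.
move=> fA fxy; apply/forallP => z; rewrite !inE (forallP fA) andbT.
by apply: contra fxy => /eqP/(inside_inj fA)[-> ->].
Qed.

Lemma inside_setD1_neq f : inside (A :\ v) f -> f x != y /\ inside A f.
Proof.
move=> /forallP fA; split; last by apply/forallP => z; have := fA z; rewrite !inE => /andP[].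
by apply: contraTneq (fA x) => ->; rewrite !inE eqxx.
Qed.

Lemma shed_vertex_in : v \in A.
Proof.
have [f] := set0Pn _ T1n0; rewrite inE => /andP[/Txy/TA/forallP/(_ x) + _].
by rewrite set_value_eq.
Qed.

(** If a face without [v] avoids [f], it still avoids [f] after the value at [x] is reset to [y],
    and the reset function stays in [T]. *)
Lemma deletion_family_complex :
  deletion v (family_complex T A) = family_complex T2 A.
Proof.
apply/setP => C; rewrite inE; apply/andP/family_complexP.
  move=> [/family_complexP[CA [f fT fC]] vC]; split => //.
  exists (set_value f x y); first by rewrite inE Txy// set_value_eq eqxx.
  exact: avoids_set_value.
move=> [CA [f]]; rewrite inE => /andP[fT /eqP fxy] fC; split.
  by apply/family_complexP; split => //; exists f.
by move/forallP: fC => /(_ x); rewrite fxy.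
Qed.

(** A function avoids [v] exactly when its value at [x] is not [y]; for functions inside [A] this
    uses the injectivity of [iota]. *)
Lemma link_family_complex :
  link v (family_complex T A) = family_complex T1 (A :\ v).
Proof.
apply/setP => C; rewrite inE; apply/andP/family_complexP.
  move=> [vC /family_complexP[vCA [f fT fC]]]; split.
    by rewrite subsetD1 vC andbT; apply: subset_trans vCA; exact: subsetU1.
  exists f; last by apply: avoidsS fC; exact: subsetU1.
  rewrite inE fT /=; apply: contraTneq isT => fxy.
  by move/forallP: fC => /(_ x); rewrite fxy !inE eqxx.
rewrite subsetD1 => -[/andP[CA vC] [f]]; rewrite inE => /andP[fT fxy] fC.
split => //; apply/family_complexP; split.
  by rewrite subUset sub1set shed_vertex_in.
exists f => //; apply/forallP => z; rewrite !inE negb_or (forallP fC) andbT.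
by have /forallP/(_ z) := inside_setD1 (TA fT) fxy; rewrite !inE => /andP[].
Qed.

(** Any member of [T1] lies inside [A] but not in [T2]. Hence the deletion is always a ball. *)
Lemma shed_deletion_not_full : ~ full T2 A.
Proof.
have [f] := set0Pn _ T1n0; rewrite inE => /andP[fT fxy] /(_ f (TA fT)).
by rewrite inE (negbTE fxy) andbF.
Qed.

(** If [T1] were full, a function [g] with [g x = y] could be moved into [T1] by borrowing another
    value at [x], and resetting that value to [y] would put [g] in [T]. *)
Lemma shed_link_not_full : ~ full T A -> ~ full T1 (A :\ v).
Proof.
move=> nfull fullT1; apply: nfull => g gA; have [gxy|gxy] := eqVneq (g x) y.
  have [f] := set0Pn _ T1n0; rewrite inE => /andP[fT fxy].
  rewrite -(set_value_id (f x) gxy); apply: Txy.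
  have /fullT1 : inside (A :\ v) (set_value g x (f x)).
    apply: inside_setD1; last by rewrite set_value_eq.
    by apply: inside_set_value => //; exact: (forallP (TA fT)).
  by rewrite inE => /andP[].
by have /fullT1 := inside_setD1 gA gxy; rewrite inE => /andP[].
Qed.

(** With [T] full, a function inside [A] is outside [T2] only by taking another value than [y] at
    [x], so the boundary witnesses of the deletion are the members of [T1]. This is the hypothesis
    of [conical_sphere_glue]. *)
Lemma shed_boundary_full : full T A ->
  {in family_complex T2 A, family_boundary T2 A =i family_complex T1 (A :\ v)}.
Proof.
move=> fullT C CT2; apply/family_boundaryP/family_complexP.
  move=> [_ [g [gT2 gA gC]]]; have gT := fullT g gA.
  have /family_complexP[CA [f]] := CT2.
  rewrite inE => /andP[fT /eqP fxy] /forallP/(_ x); rewrite fxy => vC.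
  split; first by rewrite subsetD1 CA.
  exists g => //; rewrite inE gT; apply: contra gT2 => gxy.
  by rewrite inE gT.
move=> [CA [f]]; rewrite inE => /andP[fT fxy] fC; split => //.
by exists f; split; [rewrite inE (negbTE fxy) andbF|exact: TA|].
Qed.

(** The part of the boundary of the deletion that stays on the boundary after the star is glued
    on. *)
Let M : {set {set V}} :=
  [set C in family_complex T2 A | [exists g, [&& g \notin T, inside A g & avoids C g]]].

Let MP C : reflect (C \in family_complex T2 A /\
    exists g, [/\ g \notin T, inside A g & avoids C g]) (C \in M).
Proof.
rewrite [X in reflect _ X]inE; apply: (iffP andP) => -[CA].
  by move=> /existsP[g /and3P[gT gA gC]]; split => //; exists g.
by move=> [g [gT gA gC]]; split => //; apply/existsP; exists g; apply/and3P.
Qed.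

Lemma shed_conical_ball (R : realType) :
  conical_ball R (family_complex T2 A) (family_boundary T2 A) ->
  conical_ball R (family_complex T1 (A :\ v)) (family_boundary T1 (A :\ v)) ->
  conical_ball R (family_complex T A) (family_boundary T A).
Proof.
move=> bdel blink.
have dM : down_closed M.
  move=> C C' /MP[C'T2 [g [gT gA gC']]] CC'; apply/MP; split.
    exact: down_closed_family_complex CC'.
  by exists g; split => //; exact: avoidsS gC'.
have := @conical_ball_glue R V v (family_complex T A) (family_boundary T1 (A :\ v)) M.
rewrite deletion_family_complex link_family_complex => glue.
apply: eq_conical_ball (glue _ dM _ _ _ _ blink).
- move=> C CT; rewrite inE [X in _ || X]inE; apply/orP/family_boundaryP.
    move=> [/MP[_ [g gP]]|/family_boundaryP[_ [g [gT1 /inside_setD1_neq[gxy gA] gC]]]].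
      by split => //; exists g.
    split => //; exists g; split => //.
      by apply: contra gT1 => gT; rewrite inE gT.
    apply/forallP => z; have /forallP/(_ z) := gC; rewrite !inE negb_and negbK.
    move=> /orP[|//] /eqP/(inside_inj gA)[ez egy]; move: gxy.
    by rewrite -egy ez eqxx.
  move=> [_ [g [gT gA gC]]]; have /family_complexP[CA [f fT fC]] := CT.
  (* If [v] is in [C], then [f] and [g] both avoid [v] and serve as witnesses in the link. Otherwise
     resetting [f] shows that [C] is in the deletion. *)
  have [vC|vC] := boolP (v \in C); [right|left].
    have neq h : avoids C h -> h x != y.
      by move=> /forallP/(_ x); apply: contraNneq => ->.
    apply/family_boundaryP; split.
      apply/family_complexP; split; first exact: setSD.
      exists f; first by rewrite inE fT neq.
      by apply: avoidsS fC; exact: subD1set.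
    exists g; split; first by rewrite inE (negbTE gT).
      by apply: inside_setD1 => //; exact: neq.
    by apply: avoidsS gC; exact: subD1set.
  apply/MP; split; last by exists g.
  apply/family_complexP; split => //; exists (set_value f x y).
    by rewrite inE Txy// set_value_eq eqxx.
  exact: avoids_set_value.
- exact: down_closed_family_complex.
- by apply/subsetP => C /MP[].
- by apply/subsetP => C /family_boundaryP[].
(* A witness [g] with [g x = y] must be adapted to the link, so its value at [x] is replaced by
   [f x]. The result is not in [T1], since resetting it to [y] would put [g] in [T]. *)
- apply/subsetP => C; rewrite inE => /andP[CL /MP[_ [g [gT gA gC]]]].
  apply/family_boundaryP; split => //.
  have /family_complexP[CA [f]] := CL; rewrite inE => /andP[fT fxy] fC.
  have [gxy|gxy] := eqVneq (g x) y; last first.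
    exists g; split => //; last exact: inside_setD1.
    by rewrite inE (negbTE gT).
  exists (set_value g x (f x)); split.
  + apply: contra gT; rewrite inE => /andP[/Txy + _].
    by rewrite set_value_id.
  + apply: inside_setD1; last by rewrite set_value_eq.
    by apply: inside_set_value => //; exact: (forallP (TA fT)).
  + by apply: avoids_set_value => //; exact: (forallP fC).
(* A witness outside [T2] is either in [T] with another value at [x], which gives a link face, or
   outside [T], which gives a face in [M]. *)
- apply: eq_conical_ball bdel => C CT2; rewrite [RHS]inE.
  apply/family_boundaryP/orP.
    move=> [_ [g [gT2 gA gC]]]; have [gT|gT] := boolP (g \in T); [left|right].
      have /family_complexP[CA [f]] := CT2.
      rewrite inE => /andP[fT /eqP fxy] /forallP/(_ x); rewrite fxy => vC.
      apply/family_complexP; split; first by rewrite subsetD1 CA.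
      by exists g => //; move: gT2; rewrite !inE gT.
    by apply/MP; split => //; exists g.
  move=> [/family_complexP[CA [f]]|/MP[_ [g [gT gA gC]]]].
    rewrite inE => /andP[fT fxy] fC; split => //.
    by exists f; split; [rewrite inE (negbTE fxy) andbF|exact: TA|].
  by split => //; exists g; split => //; rewrite inE (negbTE gT).
Qed.

End InAmbient.

(** Induction on the shedding. [A] is quantified inside because the link lives on [A :\ v]; the two
    gluing lemmas give the sphere and the ball case. *)
Lemma sheddable_complex (R : realType) T : sheddable T ->
  forall A, A \subset A0 -> (forall f, f \in T -> inside A f) ->
  [/\ vertex_decomposable (family_complex T A),
      full T A -> conical_sphere R (family_complex T A) &
      ~ full T A -> conical_ball R (family_complex T A) (family_boundary T A)].
Proof.
elim=> {T} [f|T x y T1n0 Txy _ IH1 _ IH2] A sA TA.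
  have fA := TA f (set11 f).
  (* Changing [f] at the pair of a vertex off its graph gives a function outside the family. Such a
     function refutes fullness, and it witnesses that the faces of the simplex without [u] are on
     the boundary. *)
  have witness u : u \in A -> u \notin image_of f ->
      exists p, u = iota p /\ set_value f p.1 p.2 \notin [set f].
    move=> uA uf; have [[x y] e] := iota_surj (subsetP sA _ uA); exists (x, y).
    split => //; rewrite inE; apply: contra uf => /eqP fxy.
    apply/imsetP; exists x => //; rewrite e; congr (iota (x, _)).
    by move/ffunP/(_ x): fxy; rewrite set_value_eq.
  rewrite family_complex1; split.
  - by apply: vd_simplex; exists (A :\: image_of f).
  - move=> fullf; rewrite (_ : A :\: image_of f = set0).
      exact: conical_sphere_powerset0.
    apply/setP => u; rewrite !inE; apply/negP => /andP[uf uA].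
    have [[x y] [e]] := witness u uA uf; rewrite fullf//.
    by apply: inside_set_value => //; rewrite -e.
  - move=> nfull; have Sn0 : A :\: image_of f != set0.
      apply: contra_not_neq nfull => /eqP; rewrite setD_eq0 => /subsetP Af g gA.
      rewrite inE; apply/eqP/ffunP => x; have /Af/imsetP[z _] := forallP gA x.
      by move=> /(inside_inj sA gA)[-> ->].
    apply: eq_conical_ball (conical_ball_simplex R Sn0) => C CS.
    rewrite [LHS]inE; apply/idP/family_boundaryP.
      rewrite properE => /andP[_ /subsetPn[u]]; rewrite inE => /andP[uf uA] uC.
      rewrite family_complex1; split => //.
      have [[x y] [e fxy]] := witness u uA uf; exists (set_value f x y).
      split => //; first by apply: inside_set_value => //; rewrite -e.
      apply: avoids_set_value; last by rewrite -e.
      by move: CS; rewrite -family_complex1 => /family_complexP[_ [_ /set1P->]].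
    move=> [_ [g [gf gA gC]]]; move: CS; rewrite inE properE => -> /=.
    apply: contra gf => SC; rewrite inE; apply/eqP/ffunP => x.
    have : iota (x, g x) \in image_of f.
      apply: contraTT (forallP gC x) => xf; rewrite negbK; apply: (subsetP SC).
      by rewrite inE xf (forallP gA).
    by move=> /imsetP[z _] /(inside_inj sA gA)[-> ->].
set v := iota (x, y).
have sA' : A :\ v \subset A0 by apply: subset_trans sA; exact: subD1set.
have [|vd1 _ ball1] := IH1 _ sA'.
  by move=> f; rewrite inE => /andP[fT fxy]; apply: inside_setD1 => //; exact: TA.
have [|vd2 _ /(_ (shed_deletion_not_full TA T1n0)) ball2] := IH2 _ sA.
  by move=> f; rewrite inE => /andP[fT _]; exact: TA.
split.
- apply: (@vd_shed _ _ v); first exact: pure_family_complex.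
  + apply/family_complexP; split; first by rewrite sub1set (shed_vertex_in TA Txy).
    have [f] := set0Pn _ T1n0; rewrite inE => /andP[fT fxy]; exists f => //.
    apply/forallP => z; rewrite inE.
    by have /forallP/(_ z) := inside_setD1 sA (TA _ fT) fxy; rewrite !inE => /andP[].
  + by rewrite deletion_family_complex.
  + by rewrite link_family_complex.
- move=> fullT; apply: (@conical_sphere_glue _ _ v).
    exact: down_closed_family_complex.
  rewrite deletion_family_complex// link_family_complex//.
  apply: eq_conical_ball ball2; exact: shed_boundary_full.
- move=> nfull; apply: (shed_conical_ball sA TA Txy T1n0 ball2).
  by apply: ball1; exact: (shed_link_not_full sA TA Txy T1n0).
Qed.

End Sheddable.

(** * Poset tableaux *)

Section PosetTableaux.
Import mathcomp.boot.fintype mathcomp.boot.finset.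
Local Open Scope set_scope.

(** The point with the fewest elements strictly below it is minimal. *)
Lemma ex_minimal d (T : finPOrderType d) (P : pred T) x0 : P x0 ->
  exists2 x, P x & forall z, P z -> ~~ (z < x)%O.
Proof.
move=> Px0; pose below (x : T) := #|[set z : T | (z < x)%O]|.
have [x Px xmin] := arg_minnP below Px0; exists x => // z /xmin.
apply: contraL => zx; rewrite -ltnNge; apply: proper_card; apply/properP; split.
  by apply/subsetP => t; rewrite !inE => /lt_trans; apply.
by exists z; rewrite !inE ?ltxx.
Qed.

Variables (dX dY : Order.disp_t) (X : finPOrderType dX) (Y : finPOrderType dY).
Variable Psi : {set X * X}.
Hypothesis Psi_lt : forall x1 x2 : X, (x1, x2) \in Psi -> (x1 < x2)%O.
Implicit Types (Yx : X -> {set Y}) (f g : {ffun X -> Y}).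

Lemma poset_tableauxP Yx f :
  reflect [/\ forall x, f x \in Yx x,
              forall x1 x2, (x1 <= x2)%O -> (f x1 <= f x2)%O &
              forall x1 x2, (x1, x2) \in Psi -> (f x1 < f x2)%O]
          (f \in poset_tableaux Yx Psi).
Proof.
rewrite [X in reflect _ X]inE.
apply: (iffP and3P) => [[/forallP fY fle flt]|[fY fle flt]]; split.
- exact: fY.
- by move=> x1 x2; move/forallP: fle => /(_ x1)/forallP/(_ x2)/implyP.
- by move=> x1 x2; move/forallP: flt => /(_ x1)/forallP/(_ x2)/implyP.
- exact/forallP.
- by apply/forallP => x1; apply/forallP => x2; apply/implyP; exact: fle.
- by apply/forallP => x1; apply/forallP => x2; apply/implyP; exact: flt.
Qed.

Definition restrict_values Yx x (Z : {set Y}) : X -> {set Y} :=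
  fun z => if z == x then Z else Yx z.

(** The two subfamilies of a shedding step are again families of poset tableaux, with fewer
    admissible values. *)
Lemma poset_tableaux_restrict Yx x (Z : {set Y}) : Z \subset Yx x ->
  poset_tableaux (restrict_values Yx x Z) Psi =
  [set f in poset_tableaux Yx Psi | f x \in Z].
Proof.
move=> /subsetP ZY; apply/setP => f; rewrite [RHS]inE.
apply/poset_tableauxP/andP => [[fY fle flt]|[/poset_tableauxP[fY fle flt] fZ]].
  split; last by have := fY x; rewrite /restrict_values eqxx.
  apply/poset_tableauxP; split => // z; have := fY z; rewrite /restrict_values.
  by case: eqP => // ->; exact: ZY.
by split => // z; rewrite /restrict_values; case: eqP => [->|].
Qed.

Lemma sum_restrict_values Yx x (Z : {set Y}) : (#|Z| < #|Yx x|)%N ->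
  (\sum_z #|restrict_values Yx x Z z| < \sum_z #|Yx z|)%N.
Proof.
move=> ZY; rewrite (bigD1 x)//= [X in (_ < X)%N](bigD1 x)//=.
rewrite /restrict_values eqxx -addSn leq_add// leq_sum// => z zx.
by rewrite (negbTE zx).
Qed.

(** Induction on the total number of admissible values. With one value at each point there is a
    single tableau; otherwise the least value at a minimal undetermined point is shed. *)
Lemma sheddable_poset_tableaux Yx :
  (forall x y1 y2, y1 \in Yx x -> y2 \in Yx x -> (y1 <= y2)%O \/ (y2 <= y1)%O) ->
  poset_tableaux Yx Psi != set0 -> sheddable (poset_tableaux Yx Psi).
Proof.
have [n] := ubnP (\sum_x #|Yx x|)%N; elim: n Yx => // n IHn Yx.
rewrite ltnS => Yn Ytot Tn0.
have [/existsP[x0 x0P]|none] := boolP [exists x, (1 < #|Yx x|)%N]; last first.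
  have [f fT] := set0Pn _ Tn0.
  rewrite (_ : poset_tableaux Yx Psi = [set f]); first exact: sheddable1.
  apply/setP => g; rewrite [RHS]inE; apply/idP/eqP => [gT|->//].
  apply/ffunP => x; have := none; rewrite negb_exists => /forallP/(_ x).
  rewrite -leqNgt => /card_le1_eqP; apply.
    by have /poset_tableauxP[] := fT.
  by have /poset_tableauxP[] := gT.
have [x xP xmin] := ex_minimal (P := fun x => (1 < #|Yx x|)%N) x0P.
(* Below [x] the minimality of [x] leaves one admissible value, so all tableaux agree there. *)
have below_eq f g z : f \in poset_tableaux Yx Psi -> g \in poset_tableaux Yx Psi ->
    (z < x)%O -> f z = g z.
  move=> /poset_tableauxP[fY _ _] /poset_tableauxP[gY _ _] zx.
  have : (#|Yx z| <= 1)%N by rewrite leqNgt; apply: contraL zx; exact: xmin.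
  by move=> /card_le1_eqP; apply.
have /card_gt0P[y0 y0P] : (0 < #|Yx x|)%N by exact: ltnW.
have [y yP ymin] := ex_minimal (P := fun y => y \in Yx x) y0P.
have yle z : z \in Yx x -> (y <= z)%O.
  move=> zY; have [//|zy] := Ytot x _ _ yP zY.
  by have := ymin z zY; rewrite lt_neqAle zy andbT negbK => /eqP ->.
have IH (Z : {set Y}) : Z \subset Yx x -> (#|Z| < #|Yx x|)%N ->
    [set f in poset_tableaux Yx Psi | f x \in Z] != set0 ->
    sheddable [set f in poset_tableaux Yx Psi | f x \in Z].
  move=> ZY Zc; rewrite -poset_tableaux_restrict//; apply: IHn.
    by apply: leq_trans Yn; exact: sum_restrict_values.
  move=> z y1 y2; rewrite /restrict_values; case: eqP => [_|_]; last exact: Ytot.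
  by move=> /(subsetP ZY) y1Y /(subsetP ZY) y2Y; exact: (Ytot x).
have e1 : [set f in poset_tableaux Yx Psi | f x != y] =
    [set f in poset_tableaux Yx Psi | f x \in Yx x :\ y].
  apply/setP => f; rewrite [LHS]inE [RHS]inE; case: (boolP (f \in _)) => //= fT.
  by rewrite in_setD1 andbC; case/poset_tableauxP: fT => ->.
have e2 : [set f in poset_tableaux Yx Psi | f x == y] =
    [set f in poset_tableaux Yx Psi | f x \in [set y]].
  by apply/setP => f; rewrite [LHS]inE [RHS]inE in_set1.
(* If all tableaux take the value [y] at [x], or none does, nothing is shed: shrinking [Yx x] leaves
   the family unchanged, and the induction hypothesis applies. *)
have [T1|T1n0] := eqVneq [set f in poset_tableaux Yx Psi | f x != y] set0.
  have e : poset_tableaux Yx Psi = [set f in poset_tableaux Yx Psi | f x == y].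
    apply/setP => f; rewrite [RHS]inE; case: (boolP (f \in _)) => //= fT.
    apply/esym; apply: contraT => fxy.
    by move/setP/(_ f): T1; rewrite [LHS]inE fT fxy inE.
  rewrite e e2; apply: IH; rewrite ?sub1set ?cards1//.
  by rewrite -e2 -e.
have [T2|T2n0] := eqVneq [set f in poset_tableaux Yx Psi | f x == y] set0.
  have e : poset_tableaux Yx Psi = [set f in poset_tableaux Yx Psi | f x != y].
    apply/setP => f; rewrite [RHS]inE; case: (boolP (f \in _)) => //= fT.
    apply/esym; apply: contraT; rewrite negbK => fxy.
    by move/setP/(_ f): T2; rewrite [LHS]inE fT fxy inE.
  rewrite e e1; apply: IH; rewrite ?subD1set -?e1 -?e//.
  by rewrite [X in (_ < X)%N](cardsD1 y) yP.
apply: (sheddable_step (x := x) (y := y) T1n0).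
(* Relations out of [x] survive the reset because [y] is at most [f x]. Relations into [x] hold for
   [g], which takes the value [y] at [x] and agrees with [f] below it. *)
- move=> f fT; have [g] := set0Pn _ T2n0; rewrite [_ \in _]inE => /andP[gT /eqP gxy].
  have /poset_tableauxP[fY fle flt] := fT.
  have /poset_tableauxP[_ gle glt] := gT.
  have yf := yle _ (fY x).
  apply/poset_tableauxP; split=> [z|x1 x2 x12|x1 x2 x12]; rewrite !ffunE.
  + by case: eqP => [->|].
  + case: (eqVneq x1 x) => [e|n1]; case: (eqVneq x2 x) => [e'|n2].
    * by [].
    * by apply: le_trans yf _; apply: fle; rewrite -e.
    * rewrite (below_eq f g)//; first by rewrite -gxy -e'; exact: gle.
      by rewrite lt_neqAle n1 -e'.
    * exact: fle.
  + case: (eqVneq x1 x) => [e|n1]; case: (eqVneq x2 x) => [e'|n2].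
    * by have := Psi_lt x12; rewrite e e' ltxx.
    * by apply: le_lt_trans yf _; apply: flt; rewrite -e.
    * rewrite (below_eq f g)//; first by rewrite -gxy -e'; exact: glt.
      by rewrite -e'; exact: Psi_lt.
    * exact: flt.
- rewrite e1; apply: IH; rewrite ?subD1set -?e1//.
  by rewrite [X in (_ < X)%N](cardsD1 y) yP.
- by rewrite e2; apply: IH; rewrite ?sub1set ?cards1 -?e2.
Qed.

End PosetTableaux.

(** * The tableau complex as the complex of a family *)

Section TableauComplex.
Import mathcomp.boot.fintype mathcomp.boot.finset.
Local Open Scope set_scope.
Variables (X Y : finType) (E : {set X * Y}).

Let A0 := [set tableau_vertex E p | p in E].

(** An element of [A0] misses exactly one pair of [E], and this pair determines it. *)
Lemma tableau_vertex_inj p q : tableau_vertex E p \in A0 ->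
  tableau_vertex E p = tableau_vertex E q -> p = q.
Proof.
move=> /imsetP[p' p'E e] epq.
have pE : p \in E.
  by move/setP/(_ p'): e; rewrite !inE eqxx p'E andbT => /negbFE/eqP <-.
apply/eqP; apply: contraT => pq.
by move/setP/(_ p): epq; rewrite !inE eqxx pq pE.
Qed.

Lemma tableau_complexE (T : {set {ffun X -> Y}}) :
  (forall f, f \in T -> graph f \subset E) ->
  tableau_complex T E = family_complex (tableau_vertex E) T A0.
Proof.
move=> TE; apply/setP => C; apply/imsetP/family_complexP.
  move=> [F]; rewrite inE => /andP[FE /exists_inP[f fT /subsetP fF]] ->.
  split; first by apply: imsetS; exact: subsetDl.
  exists f => //; apply/forallP => x; apply/negP => /imsetP[q].
  rewrite inE => /andP[qF qE] e.
  have xE : (x, f x) \in F by apply: fF; rewrite inE.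
  move: qF; rewrite -(tableau_vertex_inj _ e) ?xE//.
  by apply: imset_f; apply: (subsetP (TE f fT)); rewrite inE.
move=> [CA [f fT /forallP fC]].
(* The set [F] of the definition is recovered as the pairs of [E] whose vertices are not in [C]. *)
exists [set p in E | tableau_vertex E p \notin C].
  rewrite inE powersetE; apply/andP; split.
    by apply/subsetP => p; rewrite inE => /andP[].
  apply/exists_inP; exists f => //; apply/subsetP => -[x y] xy; rewrite inE.
  by rewrite (subsetP (TE f fT))//=; move: xy; rewrite inE /= => /eqP ->.
apply/setP => u; apply/idP/imsetP => [uC|[p]].
  have /imsetP[p pE e] := subsetP CA _ uC; exists p => //.
  by rewrite !inE pE /= andbT negbK -e.
by rewrite !inE => /andP[+ pE] ->; rewrite pE /= negbK.
Qed.

End TableauComplex.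

Theorem theorem2p8 (R : realType) (dX dY : Order.disp_t)
    (X : finPOrderType dX) (Y : finPOrderType dY)
    (Yx : X -> {set Y})
    (Yx_total : forall (x : X) (y1 y2 : Y),
        y1 \in Yx x -> y2 \in Yx x -> (y1 <= y2)%O \/ (y2 <= y1)%O)
    (Psi : {set X * X})
    (Psi_lt : forall x1 x2 : X, (x1, x2) \in Psi -> (x1 < x2)%O)
    (E : {set X * Y})
    (E_sup : (\bigcup_(f in poset_tableaux Yx Psi) graph f)%SET \subset E) :
  ball_or_sphere R (tableau_complex (poset_tableaux Yx Psi) E) /\
  vertex_decomposable (tableau_complex (poset_tableaux Yx Psi) E).
Proof.
have TE f : f \in poset_tableaux Yx Psi -> graph f \subset E.
  by move=> fT; apply: fintype.subset_trans E_sup; exact: finset.bigcup_sup.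
rewrite tableau_complexE//; set T := poset_tableaux Yx Psi in TE *.
set A := [set tableau_vertex E p | p in E]%SET.
have [T0|Tn0] := eqVneq T finset.set0.
  have -> : family_complex (tableau_vertex E) T A = finset.set0.
    apply/setP => C; rewrite !inE; apply/negP => /andP[_ /exists_inP[f]].
    by rewrite T0 inE.
  split; last exact: vd_void.
  (* Without tableaux the complex has no face at all and its realization is empty, like
     [unit_sphere R 0], where the empty sum would have to equal 1. *)
  exists 0%N; right.
  have r0 p : ~ realization R (finset.set0 : {set {set {set X * Y}}}) p.
    by move=> [_ _]; rewrite inE.
  have s0 z : ~ unit_sphere R 0 z.
    by rewrite /unit_sphere /= big_ord0 => /esym/eqP; rewrite oner_eq0.
  apply: (@homeomorphic_set_type _ _ _ _ (fun=> 0 : 'rV[R]_0)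
    (fun=> 0 : 'rV[R]_#|{set X * Y}|)); try exact: continuous_on_cst.
  - by move=> p /r0.
  - by move=> z /s0.
  - by move=> p /r0.
  - by move=> z /s0.
have TA f : f \in T -> inside (tableau_vertex E) A f.
  move=> fT; apply/forallP => x; apply: imset_f.
  by apply: (fintype.subsetP (TE f fT)); rewrite inE.
have Asurj u : u \in A -> exists p, u = tableau_vertex E p.
  by move=> /imsetP[p _ ->]; exists p.
have [vd sph bal] := @sheddable_complex X Y _ (tableau_vertex E) A
  (@tableau_vertex_inj X Y E) Asurj R T
  (sheddable_poset_tableaux Psi_lt Yx_total Tn0) A (fintype.subxx _) TA.
split => //.
have D0 := set0_family_complex (tableau_vertex E) A Tn0.
have [/sph|/bal] := pselect (full (tableau_vertex E) T A).
  by move=> /(conical_sphere_homeomorphic D0)[n nP]; exists n; right.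
by move=> /(conical_ball_homeomorphic D0)[n nP]; exists n; left.
Qed.
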